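(* Fix $\beta\in[1,2)$. Then, as $k\to\infty$ over integers $k\in\mathbb{N}$ for which $n=\beta\cdot 2^k$ is an integer, \[ \rho_{\min}(n)=2^{G(\beta)n\pm o(n)}, \] i.e. $2^{G(\beta)n-o(n)}\le \rho_{\min}(n)\le 2^{G(\beta)n+o(n)}$, where $G(\beta)$ is defined below.
   Context: Let $X_n=\{x_1,\dots,x_n\}$. A distribution $\mu$ on $X_n$ is dyadic if every $\mu(x_i)$ is either $0$ or $2^{-d}$ for some $d\in\mathbb{N}$. For a non-constant dyadic $\mu$, let $\mathrm{Spl}(\mu)_i=\{A\subseteq X_n: |A|=i,\ \mu(A)=1/2\}$ and define $\rho(\mathrm{Spl}(\mu))=\max_{i\in\{1,\dots,n-1\}}|\mathrm{Spl}(\mu)_i|/\binom{n}{i}$. Let $\rho_{\min}(n)=\min_\mu \rho(\mathrm{Spl}(\mu))$, the minimum over all non-constant dyadic distributions $\mu$ on $X_n$ with full support. Let $h$ be the binary entropy function (base 2). Here $\mathbb{N}=\{0,1,2,\dots\}$. For $\beta\in[1,2)$, let $\mathcal{C}(\beta)$ be the set of pairs $(\mathbf{c},b)$ with $b\in\mathbb{N}$ and $\mathbf{c}=(c_i)_{i\ge0}\in[0,1]^{\mathbb{N}}$ satisfying $\sum_{i\ge0}c_i/2^i=\frac{1}{\beta 2^b}$ and $\sum_{i\ge0}c_i\le1$. For $(\mathbf{c},b)\in\mathcal{C}(\beta)$ let $\mathcal{A}(\mathbf{c},b)$ be the set of $\boldsymbol{\alpha}\in[0,1]^{\mathbb{N}}$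 with $\sum_{i\ge0}\alpha_ic_i/2^i=\frac{1}{\beta 2^{b+1}}$, and let $P(\mathbf{c},\boldsymbol{\alpha})=\sum_{i\ge0}h(\alpha_i)c_i-h\big(\sum_{i\ge0}\alpha_ic_i\big)$. Define \[ G(\beta)=\inf_{(\mathbf{c},b)\in\mathcal{C}(\beta)}\ \max_{\boldsymbol{\alpha}\in\mathcal{A}(\mathbf{c},b)}P(\mathbf{c},\boldsymbol{\alpha}) \] (the inner maximum is attained). *)

(* Defs.v *)
From HB Require Import structures.
From mathcomp Require Import all_boot all_order all_algebra.
From mathcomp Require Import all_classical all_reals all_analysis.

Set Implicit Arguments.
Unset Strict Implicit.
Unset Printing Implicit Defensive.

Import Order.TTheory GRing.Theory Num.Theory.
Import numFieldNormedType.Exports.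

Local Open Scope classical_set_scope.
Local Open Scope ring_scope.

(* The ground set X_n is 'I_n. *)

Definition is_distribution (R : realType) (n : nat) (mu : 'I_n -> R) : Prop :=
  (forall x, 0 <= mu x) /\ \sum_x mu x = 1.

Definition dyadic (R : realType) (n : nat) (mu : 'I_n -> R) : Prop :=
  forall x, mu x = 0 \/ exists d : nat, mu x = 2 ^- d.

(* "Constant" is meant as for a random variable: a point mass. *)
Definition constant_distribution (R : realType) (n : nat) (mu : 'I_n -> R) :
  Prop := exists x, mu x = 1.

Definition full_support (R : realType) (n : nat) (mu : 'I_n -> R) : Prop :=
  forall x, mu x != 0.

Definition Spl (R : realType) (n : nat) (mu : 'I_n -> R) (i : nat) :
  {set {set 'I_n}} :=
  [set A : {set 'I_n} | (#|A| == i) && (\sum_(x in A) mu x == 2^-1)]%SET.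

(* The ratios are nonnegative, so starting the maximum at 0 is harmless. *)
Definition rho_Spl (R : realType) (n : nat) (mu : 'I_n -> R) : R :=
  \big[Num.max/0]_(1 <= i < n) (#|Spl mu i|%:R / 'C(n, i)%:R).

(* For n >= 2 there are such mu, and rho_Spl takes finitely many values, so the
   infimum is a minimum. *)
Definition rho_min (R : realType) (n : nat) : R :=
  inf [set rho_Spl mu | mu in [set mu : 'I_n -> R |
    [/\ is_distribution mu, dyadic mu, ~ constant_distribution mu &
        full_support mu]]].

Definition log2 (R : realType) (x : R) : R := ln x / ln 2.

(* ln 0 = 0 in the library, so the convention 0 log 0 = 0 holds. *)
Definition h (R : realType) (x : R) : R :=
  - (x * log2 x) - (1 - x) * log2 (1 - x).

(* limn is total: convergence of sum c_i has to be required explicitly, whereas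
   all the other series below converge by comparison with it or with a geometric
   series. *)
Definition calC (R : realType) (beta : R) : set ((nat -> R) * nat) :=
  [set cb : (nat -> R) * nat | let: (c, b) := cb in
    [/\ forall i, 0 <= c i <= 1,
        limn (series (fun i => c i / 2 ^+ i)) = (beta * 2 ^+ b)^-1,
        cvgn (series c) &
        limn (series c) <= 1]].

Definition calA (R : realType) (beta : R) (c : nat -> R) (b : nat) :
  set (nat -> R) :=
  [set alpha : nat -> R |
    (forall i, 0 <= alpha i <= 1) /\
    limn (series (fun i => alpha i * c i / 2 ^+ i)) = (beta * 2 ^+ b.+1)^-1].

Definition P (R : realType) (c alpha : nat -> R) : R :=
  limn (series (fun i => h (alpha i) * c i))
  - h (limn (series (fun i => alpha i * c i))).

(* For 1 <= beta, both sets are nonempty (c = (1/beta, 0, 0, ...) with b = 0;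
   alpha constantly 1/2) and P takes values in [-1, 1], so sup and inf are the
   actual ones. The supremum is attained, i.e. it is a maximum. *)
Definition G (R : realType) (beta : R) : R :=
  inf [set sup [set P cb.1 alpha | alpha in calA beta cb.1 cb.2]
      | cb in calC beta].

(* Main.v *)
(** Group the atoms of [mu] by depth [d], [mu x = 2 ^- d], and put [m d] for the
number of atoms of depth [d].  A set taking [a d] atoms at depth [d] is a split
iff [\sum_d a d / 2 ^ d = 1 / 2], and by Stirling-type bounds the number of such
sets divided by ['C(n, \sum_d a d)] is [2 ^ (n P)] up to polynomial factors,
where [P] is the functional of the definition of [G] at [c d = m d / n] and
[alpha d = a d / m d].

Upper bound: round a nearly optimal [c] down to integer counts and chain the
leftover atoms into one block of tiny mass.  A split contains all or none of the
block, and up to complement none, so the block contributes no entropy.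

Lower bound: only depths within [s] of [k] matter.  Deeper atoms have negligible
mass and stay outside the split.  Shallower atoms have negligible number but
possibly large mass, and a real [alpha] may cut them; put them all inside the
split instead.  The light atoms then need less mass than [alpha] gave them, and
scaling [alpha] down never decreases [P] (superadditivity of the entropy
functional).  If the shallow atoms alone reach mass 1/2, a small split exists. *)

Require Import Defs.
From HB Require Import structures.
From mathcomp Require Import all_boot all_order all_algebra.
From mathcomp Require Import all_classical all_reals all_analysis.
From mathcomp Require Import ring lra zify.
Import Order.TTheory GRing.Theory Num.Theory.
Import numFieldNormedType.Exports.
Local Open Scope ring_scope.

Set Implicit Arguments.
Unset Strict Implicit.
Unset Printing Implicit Defensive.

(** Two exactness constraints shape the argument: a set is a split only if its mass is exactly 1/2,
    and [P] is controlled only for [alpha] that satisfy the mass equation of [calA] exactly. When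
    passing to integers, exactness is restored by making the mass still to be filled a whole number
    of coarse units and then filling greedily. When passing to [calA], it is restored by mixing the
    filling ratios with the constant 1, which carries twice the required mass. Entropy is handled
    through the homogeneous [phi], for which concavity becomes superadditivity. The cut-off [s] is
    fixed before [n] grows (from [eps], and in the upper bound also from the chosen [c]), so
    quantities such as [2 ^ (2 * s)] or the exponent of [(n + 1) ^ (s + 1)] count as constants. The
    block of the upper bound needs spare atoms, that is [\sum c i < 1]. If [\sum c i = 1], the
    constant [alpha = 1/2] gives [P = 0]; for a nearly optimal [c] this is excluded once
    [G beta + eps < 0], and otherwise the trivial bound [rho <= 1] suffices. *)

Definition ent (R : realType) (x : R) : R := - (x * log2 x).

(* [w * h (y / w)], in a form with no division and hence no junk at [w = 0]. *)
Definition phi (R : realType) (w y : R) : R := ent y + ent (w - y) - ent w.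

(** * Entropy inequalities and moduli of continuity *)

Section Entropy.
Variable R : realType.
Implicit Types x y z w p t : R.

Lemma ln2_gt0 : 0 < ln 2 :> R.
Proof. by rewrite ln_gt0 // ltr1n. Qed.

Lemma ln2_ge_half : 2^-1 <= ln 2 :> R.
Proof.
have := @le_ln1Dx R (- 2^-1).
have -> : 1 + - 2^-1 = 2^-1 :> R by field.
rewrite lnV ?posrE // => H; have : - ln 2 <= - 2^-1 :> R by apply: H; lra.
lra.
Qed.

Lemma log2M x y : 0 < x -> 0 < y -> log2 (x * y) = log2 x + log2 y.
Proof. by move=> x0 y0; rewrite /log2 lnM ?posrE // mulrDl. Qed.

Lemma log2V x : 0 < x -> log2 x^-1 = - log2 x.
Proof. by move=> x0; rewrite /log2 lnV ?posrE // mulNr. Qed.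

Lemma log2_1 : log2 1 = 0 :> R.
Proof. by rewrite /log2 ln1 mul0r. Qed.

Lemma log2_2 : log2 2 = 1 :> R.
Proof. by rewrite /log2 divff // gt_eqF ?ln2_gt0. Qed.

Lemma log2X x n : 0 < x -> log2 (x ^+ n) = n%:R * log2 x.
Proof. by move=> x0; rewrite /log2 lnXn // mulr_natl mulrnAl. Qed.

Lemma log2_nat_prod (I : Type) (r : seq I) (Q : pred I) (F : I -> nat) :
  (forall i, Q i -> (0 < F i)%N) ->
  log2 (\prod_(i <- r | Q i) F i)%:R = \sum_(i <- r | Q i) log2 (F i)%:R :> R.
Proof.
move=> F0.
have : log2 (\prod_(i <- r | Q i) F i)%:R = \sum_(i <- r | Q i) log2 (F i)%:R :> R
  /\ (0 < \prod_(i <- r | Q i) F i)%N.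
  elim: r => [|i r [IH IH0]]; first by rewrite !big_nil log2_1.
  rewrite !big_cons; case: ifP => Qi; last by [].
  by rewrite natrM log2M ?ltr0n ?F0 // IH muln_gt0 F0.
by case.
Qed.

Lemma le_log2 x y : 0 < x -> x <= y -> log2 x <= log2 y.
Proof.
move=> x0 xy; rewrite /log2 ler_pM2r ?invr_gt0 ?ln2_gt0 // ler_ln ?posrE //.
exact: lt_le_trans x0 xy.
Qed.

Lemma powR2_log2 x : 0 < x -> 2 `^ log2 x = x.
Proof.
move=> x0; rewrite /powR (_ : 2 == 0 :> R = false); last first.
  by apply/negbTE; rewrite gt_eqF.
by rewrite /log2 divfK ?lnK ?posrE // gt_eqF // ln2_gt0.
Qed.

Lemma log2_powR2 x : log2 (2 `^ x) = x :> R.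
Proof. by rewrite /log2 ln_powR mulfK // gt_eqF ?ln2_gt0. Qed.

(** [ln x] is twice the logarithm of the square root, and [ln u < u]. A square root is good enough
    because logarithms of counts are only compared with [n]. *)
Lemma ln_le_sqrt x : 0 <= x -> ln x <= 2 * Num.sqrt x.
Proof.
rewrite le_eqVlt => /predU1P[<-|x0]; first by rewrite ln0 // sqrtr0 mulr0.
have s0 : 0 < Num.sqrt x by rewrite sqrtr_gt0.
have -> : ln x = 2 * ln (Num.sqrt x).
  by rewrite mulr_natl -lnXn // sqr_sqrtr // ltW.
by rewrite ler_pM2l // ltW // ln_sublinear.
Qed.

Lemma log2_le_sqrt x : 1 <= x -> log2 x <= 4 * Num.sqrt x.
Proof.
move=> x1; rewrite /log2 ler_pdivrMr ?ln2_gt0 //.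
have := ln_le_sqrt (le_trans ler01 x1); have := ln2_ge_half.
have : 0 <= Num.sqrt x by rewrite sqrtr_ge0.
nra.
Qed.

Lemma ent0 : ent 0 = 0 :> R. Proof. by rewrite /ent mul0r oppr0. Qed.
Lemma ent1 : ent 1 = 0 :> R. Proof. by rewrite /ent log2_1 mulr0 oppr0. Qed.

Lemma h_phi x : h x = phi 1 x.
Proof. by rewrite /h /phi ent1 subr0 /ent. Qed.

Lemma entM x y : 0 <= x -> 0 <= y -> ent (x * y) = x * ent y + y * ent x.
Proof.
rewrite le_eqVlt => /predU1P[<-|x0]; first by rewrite !(mul0r, ent0, mulr0, addr0).
rewrite le_eqVlt => /predU1P[<-|y0]; first by rewrite !(mul0r, ent0, mulr0, addr0).
by rewrite /ent log2M //; ring.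
Qed.

(** The right-hand side is the tangent line of the concave function [ent] at [p]. *)
Lemma ent_le (x p : R) : 0 <= x -> 0 < p ->
  ent x <= (- (x * ln p) + (p - x)) / ln 2.
Proof.
move=> + p0; rewrite /ent /log2 mulrA -mulNr ler_pM2r ?invr_gt0 ?ln2_gt0 //.
rewrite le_eqVlt => /predU1P[<-|x0]; first by rewrite !mul0r; lra.
have : ln (p / x) <= p / x - 1.
  have := @le_ln1Dx R (p / x - 1); rewrite addrCA subrr addr0; apply.
  by rewrite ltrBrDl subrr divr_gt0.
rewrite ln_div ?posrE // => H.
have : x * (ln p - ln x) <= x * (p / x - 1) by rewrite ler_pM2l.
rewrite (_ : x * (p / x - 1) = p - x); first lra.
by field; rewrite gt_eqF.
Qed.

(** The log-sum inequality. Each term is bounded by the tangent at the point [w * Y / W] that has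
    the common ratio [Y / W]; the linear corrections then cancel in the sum. *)
Lemma log_sum2 (w1 y1 w2 y2 : R) : 0 <= y1 <= w1 -> 0 <= y2 <= w2 ->
  (ent y1 + y1 * log2 w1) + (ent y2 + y2 * log2 w2) <=
  ent (y1 + y2) + (y1 + y2) * log2 (w1 + w2).
Proof.
move=> /andP[y10 yw1] /andP[y20 yw2].
set Y := y1 + y2; set W := w1 + w2.
have := addr_ge0 y10 y20; rewrite -/Y le_eqVlt => /predU1P[Y0|Y0].
  have -> : y1 = 0 by rewrite /Y in Y0; lra.
  have -> : y2 = 0 by rewrite /Y in Y0; lra.
  by rewrite -Y0 !ent0 !mul0r !addr0.
have W0 : 0 < W by rewrite /W /Y in Y0 *; lra.
have core (w y : R) : 0 <= y <= w ->
    ent y + y * log2 w <= y * (log2 W - log2 Y) + (w * Y / W - y) / ln 2.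
  move=> /andP[y0 yw].
  have := le_trans y0 yw; rewrite le_eqVlt => /predU1P[w0|w0].
    have -> : y = 0 by lra.
    by rewrite -w0 ent0 !mul0r subr0 mul0r !addr0.
  have p0 : 0 < w * Y / W by rewrite divr_gt0 ?mulr_gt0.
  have := ent_le y0 p0.
  have -> : ln (w * Y / W) = ln w + ln Y - ln W.
    by rewrite ln_div ?lnM ?posrE ?mulr_gt0.
  rewrite /log2; set a := ent y; set b := ln 2; set u := _ - y.
  have b0 : 0 < b := ln2_gt0.
  rewrite -(ler_pM2r b0) divfK ?gt_eqF // => H.
  rewrite -(ler_pM2r b0).
  rewrite [leLHS](_ : _ = a * b + y * ln w); last by field; rewrite gt_eqF.
  rewrite [leRHS](_ : _ = y * (ln W - ln Y) + u); last by field; rewrite gt_eqF.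
  lra.
apply: le_trans (lerD (core w1 y1 _) (core w2 y2 _)) _; rewrite ?y10 ?y20 //.
rewrite le_eqVlt; apply/orP; left; apply/eqP.
rewrite /ent -/Y -/W.
have -> : y1 * (log2 W - log2 Y) + (w1 * Y / W - y1) / ln 2 +
   (y2 * (log2 W - log2 Y) + (w2 * Y / W - y2) / ln 2) =
  Y * (log2 W - log2 Y) + (W * Y / W - Y) / ln 2.
  by rewrite /Y /W; field; rewrite !gt_eqF ?ln2_gt0 ?W0.
rewrite mulrAC divff ?gt_eqF // mul1r subrr mul0r; ring.
Qed.

(** Concavity of [h] in homogeneous form: one log-sum inequality for the chosen parts [y], one for
    the complements [w - y]. *)
Lemma phi_superadd (w1 y1 w2 y2 : R) : 0 <= y1 <= w1 -> 0 <= y2 <= w2 ->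
  phi w1 y1 + phi w2 y2 <= phi (w1 + w2) (y1 + y2).
Proof.
move=> h1 h2.
have h1' : 0 <= w1 - y1 <= w1 by lra.
have h2' : 0 <= w2 - y2 <= w2 by lra.
have := log_sum2 h1 h2; have := log_sum2 h1' h2'.
rewrite /phi (_ : w1 - y1 + (w2 - y2) = w1 + w2 - (y1 + y2)); last by ring.
have e1 : ent w1 = - (w1 * log2 w1) by [].
have e2 : ent w2 = - (w2 * log2 w2) by [].
have e3 : ent (w1 + w2) = - ((w1 + w2) * log2 (w1 + w2)) by [].
rewrite e1 e2 e3; lra.
Qed.

Lemma phi_sum_le (I : Type) (r : seq I) (Q : pred I) (w y : I -> R) :
  (forall i, Q i -> 0 <= y i <= w i) ->
  \sum_(i <- r | Q i) phi (w i) (y i) <=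
  phi (\sum_(i <- r | Q i) w i) (\sum_(i <- r | Q i) y i).
Proof.
move=> H.
suff [] : [/\ \sum_(i <- r | Q i) phi (w i) (y i) <=
  phi (\sum_(i <- r | Q i) w i) (\sum_(i <- r | Q i) y i) &
  0 <= \sum_(i <- r | Q i) y i <= \sum_(i <- r | Q i) w i] by [].
elim: r => [|i r [IH IH0]].
  by rewrite !big_nil /phi subr0 !ent0 subr0 addr0 !lexx.
rewrite !big_cons; case: ifP => Qi; last by [].
split; last by have := H i Qi; lra.
by apply: le_trans (phi_superadd (H i Qi) IH0); rewrite lerD2l.
Qed.

Lemma phi0 w : phi w 0 = 0.
Proof. by rewrite /phi ent0 subr0; lra. Qed.

Lemma phiC w y : phi w (w - y) = phi w y.
Proof. by rewrite /phi subKr [ent (w - y) + _]addrC. Qed.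

Lemma phi_ge0 w y : 0 <= y <= w -> 0 <= phi w y.
Proof.
move=> /andP[y0 yw]; have w0 := le_trans y0 yw.
have H (z : R) : 0 <= z <= w -> 0 <= ent z + z * log2 w.
  move=> /andP[]; rewrite le_eqVlt => /predU1P[<-|z0] zw.
    by rewrite ent0 mul0r addr0.
  by rewrite /ent addrC -mulrBr mulr_ge0 ?subr_ge0 ?le_log2 // ltW.
have h1 : 0 <= y <= w by lra.
have h2 : 0 <= w - y <= w by lra.
have e : ent w = - (w * log2 w) by [].
by have := H _ h1; have := H _ h2; rewrite /phi e; lra.
Qed.

Lemma phiM t w y : 0 <= t -> 0 <= y <= w -> phi (t * w) (t * y) = t * phi w y.
Proof.
move=> t0 /andP[y0 yw]; rewrite /phi -mulrBr !entM ?subr_ge0 //; last first.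
  exact: le_trans y0 yw.
ring.
Qed.

(** Adding [phi w y] to its mirror image [phi w (w - y)], superadditivity bounds twice the left side
    by [phi (2 * w) w = 2 * w]. *)
Lemma phi_le w y : 0 <= y <= w -> phi w y <= w.
Proof.
move=> yw; have w0 : 0 <= w by lra.
have yw' : 0 <= w - y <= w by lra.
have := phi_superadd yw yw'; rewrite phiC (_ : y + (w - y) = w); last by ring.
rewrite {3}/phi (_ : w + w = 2 * w); last by ring.
rewrite (_ : 2 * w - w = w); last by ring.
rewrite entM // /(ent 2) log2_2; lra.
Qed.

Lemma phi_mono w w' y : 0 <= y <= w -> w <= w' -> phi w y <= phi w' y.
Proof.
move=> yw ww'.
have H : 0 <= (0:R) <= w' - w by lra.
have := phi_superadd yw H; rewrite phi0 !addr0.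
by rewrite (_ : w + (w' - w) = w') //; ring.
Qed.

Lemma phi_h w x : 0 <= w -> 0 <= x <= 1 -> phi w (w * x) = w * h x.
Proof. by move=> w0 x01; rewrite h_phi -{1}(mulr1 w) phiM. Qed.

Lemma h_ge0 x : 0 <= x <= 1 -> 0 <= h x.
Proof. by move=> ?; rewrite h_phi phi_ge0. Qed.

Lemma h_le1 x : 0 <= x <= 1 -> h x <= 1.
Proof. by move=> ?; rewrite h_phi phi_le. Qed.

Lemma h0 : h 0 = 0 :> R. Proof. by rewrite h_phi phi0. Qed.

Lemma h_half : h 2^-1 = 1 :> R.
Proof.
rewrite /h (_ : 1 - 2^-1 = 2^-1 :> R); last by field.
by rewrite log2V // log2_2; field.
Qed.

Lemma ent_le_sqrt t : 0 <= t -> ent t <= 4 * Num.sqrt t.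
Proof.
rewrite le_eqVlt => /predU1P[<-|t0]; first by rewrite ent0 mulr_ge0 ?sqrtr_ge0.
have s0 : 0 < Num.sqrt t by rewrite sqrtr_gt0.
rewrite /ent /log2 mulrA -mulNr ler_pdivrMr ?ln2_gt0 //.
have E : t = Num.sqrt t ^+ 2 by rewrite sqr_sqrtr // ltW.
have L : ln t = - (2 * ln (Num.sqrt t)^-1).
  by rewrite lnV ?posrE // mulrN opprK mulr_natl -lnXn // -E.
have iv : ln (Num.sqrt t)^-1 <= (Num.sqrt t)^-1 by rewrite ltW // ln_sublinear ?invr_gt0.
have b0 := ln2_ge_half.
have : t * ln (Num.sqrt t)^-1 <= Num.sqrt t.
  apply: le_trans (_ : t * (Num.sqrt t)^-1 <= _); first by rewrite ler_pM2l.
  by rewrite {1}E expr2 mulfK // gt_eqF.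
have : 0 <= Num.sqrt t * (ln 2 - 2^-1) by rewrite mulr_ge0 ?subr_ge0 // ltW.
rewrite L; move: (ln (Num.sqrt t)^-1) (ln 2) (Num.sqrt t) => l b s H1 H2; lra.
Qed.

(** The upper side is subadditivity of [ent] (nonnegativity of [phi]) followed by
    [ent t <= 4 * sqrt t]; the lower side is the tangent bound at [x + t], which loses at most
    [t / ln 2 <= 2 * t]. *)
Lemma ent_uc_lt x t : 0 <= x -> 0 < t -> x + t <= 1 ->
  `|ent (x + t) - ent x| <= 6 * Num.sqrt t.
Proof.
move=> x0 t0 xt.
have t1 : t <= Num.sqrt t.
  have E : t = Num.sqrt t * Num.sqrt t by rewrite -expr2 sqr_sqrtr // ltW.
  have sq1 : Num.sqrt t <= 1 by rewrite -sqrtr1 ler_wsqrtr //; lra.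
  by rewrite [leLHS]E ler_piMl ?sqrtr_ge0.
have s0 := sqrtr_ge0 t.
have e4 := ent_le_sqrt (ltW t0).
rewrite ler_norml; apply/andP; split; last first.
  have : 0 <= phi (x + t) x by rewrite phi_ge0 //; lra.
  by rewrite /phi (_ : x + t - x = t); [lra | ring].
have xt0 : 0 < x + t by lra.
have := ent_le x0 xt0.
rewrite ler_pdivlMr ?ln2_gt0 // => H.
have b0 := ln2_ge_half.
have E : ent (x + t) * ln 2 = - ((x + t) * ln (x + t)).
  by rewrite /ent /log2 mulrA mulNr divfK // gt_eqF ?ln2_gt0.
have L0 : t * ln (x + t) <= 0 by rewrite mulr_ge0_le0 ?ln_le0 // ltW.
have D : (ent x - ent (x + t)) * ln 2 <= t by rewrite mulrBl E; lra.
have [d0|d0] := lerP (ent x - ent (x + t)) 0; first lra.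
have : (ent x - ent (x + t)) * 2^-1 <= t by apply: le_trans D; rewrite ler_pM2l.
lra.
Qed.

Lemma ent_uc x y : 0 <= x <= 1 -> 0 <= y <= 1 ->
  `|ent x - ent y| <= 6 * Num.sqrt `|x - y|.
Proof.
wlog xy : x y / y <= x.
  move=> H x01 y01; case: (leP y x) => [yx|/ltW xy]; first exact: H.
  by rewrite distrC [`|x - y|]distrC; apply: H.
move=> x01 y01; rewrite [`|x - y|]ger0_norm ?subr_ge0 //.
move: xy; rewrite le_eqVlt => /predU1P[->|xy].
  by rewrite !subrr normr0 sqrtr0 mulr0.
have := @ent_uc_lt y (x - y); rewrite (_ : y + (x - y) = x); last by ring.
by apply; lra.
Qed.

Lemma h_uc x y t : 0 <= x <= 1 -> 0 <= y <= 1 -> `|x - y| <= t ->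
  `|h x - h y| <= 12 * Num.sqrt t.
Proof.
move=> x01 y01 xyt.
have st : Num.sqrt `|x - y| <= Num.sqrt t by rewrite ler_wsqrtr.
rewrite !h_phi /phi ent1 !subr0.
have H1 := ent_uc x01 y01.
have x01' : 0 <= 1 - x <= 1 by lra.
have y01' : 0 <= 1 - y <= 1 by lra.
have := ent_uc x01' y01'.
rewrite (_ : 1 - x - (1 - y) = - (x - y)); last by ring.
rewrite normrN.
rewrite (_ : _ + _ - (_ + _) = (ent x - ent y) + (ent (1 - x) - ent (1 - y))); last by ring.
move=> H2; apply: le_trans (ler_normD _ _) _; lra.
Qed.

Lemma phi_uc w y y' t : 0 <= y <= w -> 0 <= y' <= w -> w <= 1 ->
  `|y - y'| <= t -> `|phi w y - phi w y'| <= 12 * Num.sqrt t.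
Proof.
move=> yw yw' w1 xyt.
have st : Num.sqrt `|y - y'| <= Num.sqrt t by rewrite ler_wsqrtr.
have a1 : 0 <= y <= 1 by lra.
have a2 : 0 <= y' <= 1 by lra.
have a3 : 0 <= w - y <= 1 by lra.
have a4 : 0 <= w - y' <= 1 by lra.
have := ent_uc a1 a2; have := ent_uc a3 a4.
rewrite (_ : w - y - (w - y') = - (y - y')); last by ring.
rewrite normrN /phi.
rewrite (_ : _ + _ - _ - (_ + _ - _) = (ent y - ent y') + (ent (w - y) - ent (w - y'))); last by ring.
move=> H1 H2; apply: le_trans (ler_normD _ _) _; lra.
Qed.

End Entropy.

(** * The entropy functional under scaling of the chosen amounts *)

Section Scaling.
Variable R : realType.
Implicit Types w y lam : R.

(** The chain rule for the partition of [w] into [lam * y], [lam * (w - y)] and [(1 - lam) * w]: its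
    entropy is computed by splitting off [lam * y] first, or [lam * w] first. *)
Lemma phi_scale1 w y lam : 0 <= y <= w -> 0 <= lam <= 1 ->
  phi w (lam * y) =
  lam * phi w y + w * h lam - phi (w - lam * y) (lam * (w - y)).
Proof.
move=> /andP[y0 yw] /andP[l0 l1]; have w0 := le_trans y0 yw.
rewrite /phi (_ : w - lam * y - lam * (w - y) = (1 - lam) * w); last by ring.
by rewrite !entM ?subr_ge0 // h_phi /phi ent1; ring.
Qed.

Variables (I : Type) (r : seq I) (Q : pred I) (w y : I -> R).
Hypothesis yw : forall i, Q i -> 0 <= y i <= w i.
Hypothesis w1 : \sum_(i <- r | Q i) w i <= 1.

Let Y := \sum_(i <- r | Q i) y i.
Let W := \sum_(i <- r | Q i) w i.

Let YW : 0 <= Y <= W.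
Proof.
rewrite sumr_ge0; last by move=> i /yw /andP[].
by apply: ler_sum => i /yw /andP[].
Qed.

Lemma sum_phi_le_h : \sum_(i <- r | Q i) phi (w i) (y i) <= h Y.
Proof.
by rewrite h_phi; apply: le_trans (phi_sum_le _ yw) _; exact: phi_mono.
Qed.

(* By superadditivity of [phi], the difference is concave in [lam]; it vanishes
   at [lam = 0] and is nonpositive at [lam = 1]. *)
Lemma phi_scale (lam : R) : 0 <= lam <= 1 ->
  \sum_(i <- r | Q i) phi (w i) (y i) - h Y <=
  \sum_(i <- r | Q i) phi (w i) (lam * y i) - h (lam * Y).
Proof.
move=> l01; have := YW; have Ple := sum_phi_le_h => YW'.
rewrite [X in _ <= X - _](eq_bigr (fun i => lam * phi (w i) (y i) + w i * h lam
  - phi (w i - lam * y i) (lam * (w i - y i)))); last first.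
  by move=> i /yw ?; rewrite phi_scale1.
rewrite [X in _ <= X - _]sumrB [X in _ <= X - _ - _]big_split /=.
rewrite -mulr_sumr -mulr_suml -/W.
have Y1 : 0 <= Y <= 1 by move: YW' w1; rewrite -/W; lra.
have hE := phi_scale1 Y1 l01; rewrite -!h_phi mul1r in hE; rewrite {}hE.
have S1 : \sum_(i <- r | Q i) phi (w i - lam * y i) (lam * (w i - y i)) <=
    phi (W - lam * Y) (lam * (W - Y)).
  have -> : W - lam * Y = \sum_(i <- r | Q i) (w i - lam * y i).
    by rewrite sumrB -mulr_sumr /W /Y.
  have -> : lam * (W - Y) = \sum_(i <- r | Q i) (lam * (w i - y i)).
    by rewrite -mulr_sumr sumrB /W /Y.
  by apply: phi_sum_le => i /yw /andP[? ?]; apply/andP; split; nra.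
have B1 : 0 <= lam * (W - Y) <= W - lam * Y.
  by move: l01 => /andP[? ?]; move: YW' => /andP[? ?]; apply/andP; split; nra.
(* The function [h] refers to total weight 1 while the cells weigh only [W]; the missing [1 - W] is
   treated as one more cell, thinned by [lam]. *)
have B2 : 0 <= (1 - W) * lam <= 1 - W.
  by move: l01 w1 => /andP[? ?]; rewrite -/W => ?; apply/andP; split; nra.
have := phi_superadd B1 B2; rewrite phi_h //; last by rewrite subr_ge0.
rewrite (_ : W - lam * Y + (1 - W) = 1 - lam * Y); last by ring.
rewrite (_ : lam * (W - Y) + (1 - W) * lam = lam * (1 - Y)); last by ring.
move=> S2.
have : (1 - lam) * (\sum_(i <- r | Q i) phi (w i) (y i) - h Y) <= 0.
  by rewrite mulr_ge0_le0 ?subr_ge0 ?subr_le0 //; case/andP: l01.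
lra.
Qed.

End Scaling.

(** * Entropy bounds for binomial coefficients *)

Section Binomial.

(** This is [m ^ m] times the probability of the value [j] under the binomial law with parameters
    [m] and [a / m]. Its mode is [j = a]. *)
Let bterm (m a j : nat) := ('C(m, j) * (a ^ j * (m - a) ^ (m - j)))%N.

Lemma bterm_step m a j : (j < m)%N ->
  (bterm m a j.+1 * (j.+1 * (m - a)) = bterm m a j * ((m - j) * a))%N.
Proof.
move=> jm; rewrite /bterm.
have E : ((m - a) ^ (m - j) = (m - a) ^ (m - j.+1) * (m - a))%N.
  by rewrite -expnSr; congr (_ ^ _)%N; lia.
have E2 : (j.+1 * 'C(m, j.+1) = (m - j) * 'C(m, j))%N by rewrite mul_bin_left.
rewrite E expnSr.
transitivity ((j.+1 * 'C(m, j.+1)) * (a ^ j * a * (m - a) ^ (m - j.+1) * (m - a)))%N.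
  by lia.
by rewrite E2; lia.
Qed.

Lemma bterm_max m a j : (a <= m)%N -> (j <= m)%N -> (bterm m a j <= bterm m a a)%N.
Proof.
move=> am jm; case: (leqP j a) => [ja|/ltnW aj].
- have [k -> {j ja jm}] : exists k, j = (a - k)%N by exists (a - j)%N; rewrite subKn.
  elim: k => [|k IH]; first by rewrite subn0.
  apply: leq_trans IH; case: (leqP a k) => [ak|ka].
    by have -> : (a - k.+1 = a - k)%N by lia.
  have Ej : (a - k = (a - k.+1).+1)%N by lia.
  rewrite Ej; set j := (a - k.+1)%N in Ej *.
  have jm : (j < m)%N by lia.
  have := bterm_step a jm; set t := bterm m a j; set t' := bterm m a j.+1 => E.
  have : (t * ((m - j) * a) <= t' * ((m - j) * a))%N.
    by rewrite -E leq_mul2l mulnC leq_mul ?orbT //; lia.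
  by rewrite leq_pmul2r // muln_gt0; apply/andP; split; lia.
- have [k Ek] : exists k, j = (a + k)%N by exists (j - a)%N; rewrite subnKC.
  rewrite Ek in jm *; clear Ek aj j; elim: k jm => [|k IH] jm; first by rewrite addn0.
  have jm' : (a + k < m)%N by lia.
  apply: leq_trans (IH (ltnW jm')).
  rewrite addnS; set j := (a + k)%N in jm' *.
  have := bterm_step a jm'; set t := bterm m a j; set t' := bterm m a j.+1 => E.
  have : (t' * (j.+1 * (m - a)) <= t * (j.+1 * (m - a)))%N.
    by rewrite E leq_mul2l mulnC leq_mul ?orbT //; lia.
  by rewrite leq_pmul2r // muln_gt0; apply/andP; split; lia.
Qed.

Lemma sum_bterm m a : (a <= m)%N -> (\sum_(j < m.+1) bterm m a j = m ^ m)%N.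
Proof.
move=> am; transitivity (((m - a) + a) ^ m)%N; last by rewrite subnK.
rewrite expnDn; apply: eq_bigr => i _.
by rewrite /bterm [(a ^ _ * _)%N]mulnC.
Qed.

(** The [m + 1] terms [bterm m a j] sum to [m ^ m], and the one at [j = a] is the largest. The
    convention [0 ^ 0 = 1] covers the end points [a = 0] and [a = m]. *)
Lemma bin_entropy_nat m a : (a <= m)%N ->
  ('C(m, a) * (a ^ a * (m - a) ^ (m - a)) <= m ^ m <=
   m.+1 * ('C(m, a) * (a ^ a * (m - a) ^ (m - a))))%N.
Proof.
move=> am; rewrite -(sum_bterm am); apply/andP; split.
  have am' : (a < m.+1)%N by [].
  by rewrite (bigD1 (Ordinal am')) //= leq_addr.
rewrite -[X in (X * _)%N]card_ord -sum_nat_const.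
by apply: leq_sum => -[j jm] _; apply: bterm_max.
Qed.

Variable R : realType.

Lemma log2_expnn (n : nat) : log2 (n ^ n)%:R = - ent n%:R :> R.
Proof.
case: n => [|n]; first by rewrite expn0 ent0 log2_1 oppr0.
by rewrite natrX log2X ?ltr0n // /ent opprK.
Qed.

Lemma log2_bin (m a : nat) : (a <= m)%N ->
  phi (m%:R : R) a%:R - log2 m.+1%:R <= log2 'C(m, a)%:R <= phi (m%:R : R) a%:R.
Proof.
move=> am; have /andP[] := bin_entropy_nat am.
have C0 : 0 < 'C(m, a)%:R :> R by rewrite ltr0n bin_gt0.
have nn0 n : 0 < (n ^ n)%:R :> R by rewrite ltr0n expn_gt0; case: n.
have E : log2 ('C(m, a) * (a ^ a * (m - a) ^ (m - a)))%:R =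
    log2 'C(m, a)%:R - ent a%:R - ent (m - a)%:R :> R.
  rewrite 2!natrM log2M ?mulr_gt0 ?nn0 // log2M ?nn0 //.
  by rewrite !log2_expnn; ring.
have B0 : 0 < ('C(m, a) * (a ^ a * (m - a) ^ (m - a)))%:R :> R.
  by rewrite 2!natrM !mulr_gt0 ?nn0.
rewrite -!(ler_nat R) => H1 H2.
have := le_log2 B0 H1; have := le_log2 (nn0 m) H2.
rewrite [(m.+1 * _)%:R]natrM [log2 (m.+1%:R * _)]log2M ?ltr0n // -?(ltr0n R) //.
rewrite E log2_expnn natrB // /phi; lra.
Qed.

End Binomial.

(** * Sets with prescribed counts per depth, and greedy dyadic filling *)

Section Counting.
Import mathcomp.boot.finset.
Variables (T : finType) (d : T -> nat).

Definition cell (j : nat) : {set T} := [set x | d x == j]%SET.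

Definition with_counts (a : nat -> nat) (N : nat) : {set {set T}} :=
  [set A : {set T} | (A \subset [set x | (d x < N)%N]%SET) &&
    [forall j : 'I_N, #|A :&: cell j| == a j]]%SET.

(** Induction on [N]: a set is determined by its part at depths below [N] and its part in [cell N],
    and these two are chosen independently. *)
Lemma card_with_counts a N :
  #|with_counts a N| = (\prod_(j < N) 'C(#|cell j|, a j))%N.
Proof.
elim: N => [|N IH].
  rewrite big_ord0 (_ : with_counts a 0 = [set set0]%SET) ?cards1 //.
  apply/setP => A; rewrite !inE -subset0.
  have -> : [set x | (d x < 0)%N]%SET = set0 :> {set T}.
    by apply/setP => x; rewrite !inE ltn0.
  by rewrite andb_idr // => _; apply/forallP => -[].
rewrite big_ord_recr /= -IH -cards_draws -cardsX.
pose f (A : {set T}) := ((A :&: [set x | (d x < N)%N])%SET, (A :&: cell N)%SET).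
pose U : {set T} := [set x | (d x < N)%N]%SET.
have UN : [set x | (d x < N.+1)%N]%SET = (U :|: cell N)%SET.
  by apply/setP => x; rewrite !inE ltnS leq_eqVlt orbC.
have UcN : (U :&: cell N = set0)%SET.
  apply/setP => x; rewrite !inE; apply/negP => /andP[lt /eqP E].
  by rewrite E ltnn in lt.
have Ucj j : (j < N)%N -> (U :&: cell j = cell j)%SET.
  move=> jN; apply/setIidPr; apply/fintype.subsetP => x; rewrite !inE => /eqP ->.
  exact: jN.
have cNj j : (j < N)%N -> (cell N :&: cell j = set0)%SET.
  move=> jN; apply/setP => x; rewrite !inE; apply/negP => /andP[/eqP -> /eqP E].
  by rewrite E ltnn in jN.
rewrite -(@card_in_imset _ _ f (with_counts a N.+1)); last first.
  move=> A B; rewrite !inE UN => /andP[/setIidPl AU _] /andP[/setIidPl BU _].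
  by case=> E1 E2; rewrite -AU -BU !setIUr E1 E2.
congr #|pred_of_set _|; apply/setP => -[B C]; apply/imsetP/setXP.
- case=> A; rewrite [A \in _]inE => /andP[_ /forallP cA] [-> ->]; split.
    rewrite inE subsetIr /=; apply/forallP => j.
    have := cA (widen_ord (leqnSn N) j); rewrite /= -setIA -/U Ucj //.
  by rewrite inE subsetIr; have := cA ord_max.
- rewrite !inE => -[/andP[BU /forallP cB] /andP[CN /eqP cC]].
  have BN : (B :&: cell N = set0)%SET.
    by apply/eqP; rewrite -subset0 -UcN setSI.
  have CU : (C :&: U = set0)%SET.
    by apply/eqP; rewrite -subset0 -UcN [(U :&: _)%SET]setIC setSI.
  exists (B :|: C)%SET; last first.
    rewrite /f -/U !setIUl CU BN setU0 set0U.
    by move/setIidPl: BU ->; move/setIidPl: CN ->.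
  rewrite inE UN setUSS //=; apply/forallP => j.
  rewrite setIUl; case: (unliftP ord_max j) => [j'|] ->.
    have jN : (lift ord_max j' < N)%N by rewrite lift_max.
    have -> : (C :&: cell (lift ord_max j') = set0)%SET.
      by apply/eqP; rewrite -subset0 -(cNj _ jN) setSI.
    by rewrite setU0 lift_max cB.
  by rewrite /= BN set0U; move/setIidPl: CN => ->; rewrite cC.
Qed.

End Counting.

(** Greedy choice from heavy to light. If the heaviest level has at least [D] pieces, [D] of them
    finish the job; otherwise all are taken and the remaining demand, in units half as large, goes
    to the next level. Since each size divides the larger ones, nothing overshoots. *)
Lemma dyadic_fill (L : nat) : forall (r : nat -> nat) (D : nat),
  (D * 2 ^ L <= \sum_(j < L) r j * 2 ^ (L - j))%N ->
  exists2 e : nat -> nat, forall j, (e j <= r j)%N &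
    (\sum_(j < L) e j * 2 ^ (L - j) = D * 2 ^ L)%N.
Proof.
elim: L => [|L IH] r D.
  rewrite big_ord0 muln1 leqn0 => /eqP ->.
  by exists (fun=> 0%N) => //; rewrite big_ord0.
rewrite big_ord_recl /= subn0.
under eq_bigr do rewrite /bump add1n subSS.
move=> H; case: (leqP D (r 0%N)) => [Dr|rD].
  exists (fun j => if j == 0%N then D else 0%N) => [[|j]//|].
  by rewrite big_ord_recl /= big1 // ?addn0 // subn0.
have /(IH (fun j => r j.+1)) [e er eE] : ((D - r 0) * 2 * 2 ^ L <= \sum_(j < L) r j.+1 * 2 ^ (L - j))%N.
  by rewrite -mulnA -expnS mulnBl leq_subLR.
exists (fun j => if j is j'.+1 then e j' else r 0%N) => [[|j]//|].
rewrite big_ord_recl /= subn0.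
under eq_bigr do rewrite /bump add1n subSS.
by rewrite eE -mulnA -expnS mulnBl subnKC // leq_mul2r ltnW ?orbT.
Qed.

(** * Series and basic properties of [G] *)

Section Series.
Local Open Scope classical_set_scope.
Local Open Scope ring_scope.
Variable R : realType.
Implicit Types u v c : nat -> R.

Lemma seriesE u n : series u n = \sum_(i < n) u i.
Proof. by rewrite /series /= big_mkord. Qed.

Lemma partial_sum_le_lim u n : (forall i, 0 <= u i) -> cvgn (series u) ->
  \sum_(i < n) u i <= limn (series u).
Proof.
move=> u0 cu; rewrite -seriesE; apply: nondecreasing_cvgn_le => //.
by apply/nondecreasing_seqP => k; rewrite !seriesE big_ord_recr /= lerDl.
Qed.

Lemma series_comb_cvg u v (a b : R) : cvgn (series u) -> cvgn (series v) ->
  series (fun i => a * u i + b * v i) @ \oo -->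
  a * limn (series u) + b * limn (series v).
Proof.
move=> cu cv.
rewrite (_ : series _ = (fun n => a * series u n + b * series v n)); last first.
  by apply/funext => n; rewrite !seriesE big_split /= !mulr_sumr.
by apply: cvgD; apply: cvgMr.
Qed.

Lemma lim_series_comb u v (a b : R) : cvgn (series u) -> cvgn (series v) ->
  limn (series (fun i => a * u i + b * v i)) =
  a * limn (series u) + b * limn (series v).
Proof. by move=> cu cv; apply/cvg_lim => //; exact: series_comb_cvg. Qed.

Lemma finite_series_cvg u N : (forall i, (N <= i)%N -> u i = 0) ->
  series u @ \oo --> \sum_(i < N) u i.
Proof.
move=> u0; apply: cvg_near_cst; near=> n; rewrite seriesE.
have Nn : (N <= n)%N by near: n; exact: nbhs_infty_ge.
rewrite -!(big_mkord xpredT u) (@big_cat_nat _ _ _ N) //=.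
rewrite [X in _ + X]big_nat_cond [X in _ + X]big1 ?addr0 //.
by move=> i /andP[/andP[Ni _] _]; exact: u0.
Unshelve. all: by end_near. Qed.

Lemma lim_finite_series u N : (forall i, (N <= i)%N -> u i = 0) ->
  limn (series u) = \sum_(i < N) u i.
Proof. by move=> u0; apply/cvg_lim => //; exact: finite_series_cvg. Qed.

End Series.

Section GFacts.
Local Open Scope classical_set_scope.
Local Open Scope ring_scope.
Variables (R : realType) (beta : R).
Hypothesis hbeta : 1 <= beta.
Implicit Types (c alpha : nat -> R) (b : nat).

Lemma calC_cvg c b : calC beta (c, b) -> cvgn (series c).
Proof. by case. Qed.

Lemma weighted_cvg c b (f : nat -> R) : calC beta (c, b) ->
  (forall i, 0 <= f i <= 1) -> cvgn (series (fun i => f i * c i)).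
Proof.
move=> [c01 _ cc _] f01; apply: series_le_cvg cc => k.
- by have := c01 k; have := f01 k => /andP[? ?] /andP[? ?]; rewrite mulr_ge0.
- by case/andP: (c01 k).
- by rewrite ler_piMl //; [case/andP: (c01 k) | case/andP: (f01 k)].
Qed.

Lemma weighted_lim_bounds c b (f : nat -> R) : calC beta (c, b) ->
  (forall i, 0 <= f i <= 1) -> 0 <= limn (series (fun i => f i * c i)) <= 1.
Proof.
move=> C f01; have cf := weighted_cvg C f01; have [c01 _ cc c1] := C.
have fc0 i : 0 <= f i * c i.
  by have := c01 i; have := f01 i => /andP[? ?] /andP[? ?]; rewrite mulr_ge0.
apply/andP; split.
  by have := partial_sum_le_lim 0 fc0 cf; rewrite big_ord0.
apply: le_trans c1; apply: lim_series_le => // i.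
by rewrite ler_piMl //; [case/andP: (c01 i) | case/andP: (f01 i)].
Qed.

Lemma calC_geom_cvg c b : calC beta (c, b) ->
  cvgn (series (fun i => c i / 2 ^+ i)).
Proof.
move=> C; rewrite (_ : (fun i => c i / 2 ^+ i) = (fun i => (2 ^+ i)^-1 * c i)).
  apply: (weighted_cvg C) => i.
  by rewrite invr_ge0 exprn_ge0 //= invf_le1 ?exprn_gt0 // exprn_ege1 // ler1n.
by apply/funext => i; rewrite mulrC.
Qed.

Lemma calA_half c b : calC beta (c, b) -> calA beta c b (fun=> 2^-1).
Proof.
move=> C; split=> [i|]; first lra.
have cg := calC_geom_cvg C.
rewrite (_ : (fun i => _) = (fun i => 2^-1 * (c i / 2 ^+ i) + 0 * (c i / 2 ^+ i))).
  rewrite lim_series_comb // mul0r addr0; have [_ -> _ _] := C.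
  by rewrite exprS -invfM; congr (_^-1); ring.
by apply/funext => i; rewrite mul0r addr0 mulrA.
Qed.

Lemma h01 alpha : (forall i, 0 <= alpha i <= 1) ->
  forall i, 0 <= h (alpha i) <= 1.
Proof. by move=> a01 i; rewrite h_ge0 ?h_le1. Qed.

Lemma P_bounds c b alpha : calC beta (c, b) ->
  (forall i, 0 <= alpha i <= 1) -> -1 <= P c alpha <= 1.
Proof.
move=> C a01.
have B := weighted_lim_bounds C (h01 a01); have A := weighted_lim_bounds C a01.
have := h_ge0 A; have := h_le1 A; move: B; rewrite /P /=; lra.
Qed.

Let supP (cb : (nat -> R) * nat) := sup [set P cb.1 alpha | alpha in calA beta cb.1 cb.2].

Lemma has_sup_P c b : calC beta (c, b) ->
  has_sup [set P c alpha | alpha in calA beta c b].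
Proof.
move=> C; split; first by exists (P c (fun=> 2^-1)), (fun=> 2^-1) => //; exact: calA_half.
by exists 1 => _ [alpha [a01 _] <-]; have /andP[] := P_bounds C a01.
Qed.

Lemma point_calC : calC beta (fun i => if i == 0%N then beta^-1 else 0, 0%N).
Proof.
have b0 : 0 < beta by exact: lt_le_trans ltr01 hbeta.
have bi1 : beta^-1 <= 1 by rewrite invf_le1.
have F (f : nat -> R) : limn (series (fun i => (if i == 0%N then beta^-1 else 0) * f i)) = beta^-1 * f 0%N.
  by rewrite (@lim_finite_series _ _ 1) ?big_ord1 // => -[|i] //= _; rewrite mul0r.
split.
- by move=> i; case: ifP => _; rewrite ?lexx ?ler01 // invr_ge0 ltW.
- by rewrite F !expr0 invr1 !mulr1.
- apply/cvg_ex; eexists; apply: (@finite_series_cvg _ _ 1) => -[|i] //.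
- by rewrite (@lim_finite_series _ _ 1) ?big_ord1 // => -[|i].
Qed.

Lemma has_inf_supP : has_inf [set supP cb | cb in calC beta].
Proof.
split; first by eexists; eexists; [exact: point_calC | reflexivity].
exists (-1) => _ [[c b] C <-] /=.
apply: le_trans (_ : P c (fun=> 2^-1) <= _).
  have [half01 _] := calA_half C.
  by have /andP[] := P_bounds C half01.
apply: ub_le_sup; first by case: (has_sup_P C).
by exists (fun=> 2^-1) => //; exact: calA_half.
Qed.

(** The form of the infimum used in the upper bound: one fixed [c] for which every admissible
    [alpha] is controlled. *)
Lemma G_approx (eps : R) : 0 < eps -> exists2 cb, calC beta cb &
  forall alpha, calA beta cb.1 cb.2 alpha -> P cb.1 alpha <= G beta + eps.
Proof.
move=> e0; have [_ [[c b] C <-] H] := inf_adherent e0 has_inf_supP.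
exists (c, b) => //= alpha A; apply: le_trans (ltW H).
apply: ub_le_sup; first by case: (has_sup_P C).
by exists alpha.
Qed.

(** The form used in the lower bound: [c] comes from the given distribution, and a nearly optimal
    [alpha] is good enough. *)
Lemma G_witness c b (eps : R) : 0 < eps -> calC beta (c, b) ->
  exists2 alpha, calA beta c b alpha & G beta - eps <= P c alpha.
Proof.
move=> e0 C; have [_ [alpha A <-] H] := sup_adherent e0 (has_sup_P C).
exists alpha => //; apply: le_trans (ltW H); rewrite lerD2r.
by apply: ge_inf; [case: has_inf_supP | exists (c, b)].
Qed.

Lemma P_finite c alpha N : (forall i, (N <= i)%N -> c i = 0) ->
  P c alpha = \sum_(i < N) h (alpha i) * c i - h (\sum_(i < N) alpha i * c i).
Proof.
move=> c0; rewrite /P !(@lim_finite_series _ _ N) //.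
- by move=> i /c0 ->; rewrite mulr0.
- by move=> i /c0 ->; rewrite mulr0.
Qed.

(** For [c] concentrated at index 0, [P] is [phi w y - phi 1 y] with [w = 1 / beta <= 1], and [phi]
    is monotone in the weight. *)
Lemma G_le0 : G beta <= 0.
Proof.
have b0 : 0 < beta by exact: lt_le_trans ltr01 hbeta.
have bi1 : beta^-1 <= 1 by rewrite invf_le1.
apply/ler_addgt0Pr => e e0; rewrite add0r.
have [alpha [a01 _]] := G_witness e0 point_calC.
rewrite (@P_finite _ _ 1); last by case.
rewrite !big_ord1 /= lerBlDl => H; apply: le_trans H _.
have /andP[a0 a1] := a01 0%N.
have bi0 : 0 <= beta^-1 by rewrite invr_ge0 ltW.
rewrite gerDl subr_le0 mulrC -phi_h ?a01 // [alpha _ * _]mulrC h_phi.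
by apply: phi_mono => //; rewrite mulr_ge0 //= ler_piMr.
Qed.

(** Serves to exclude total weight 1 for a nearly optimal [c] when [G] is negative enough, so that
    the construction for the upper bound has atoms to spare. *)
Lemma P_half c b : calC beta (c, b) -> limn (series c) = 1 ->
  P c (fun=> 2^-1) = 0.
Proof.
move=> C c1; have cc := calC_cvg C; rewrite /P h_half.
have L (a : R) : limn (series (fun i => a * c i)) = a.
  rewrite (_ : (fun i => _) = (fun i => a * c i + 0 * c i)).
    by rewrite lim_series_comb // c1 mulr1 mul0r addr0.
  by apply/funext => i; rewrite mul0r addr0.
by rewrite !L h_half subrr.
Qed.

End GFacts.

(** * From count vectors to the ratio of splits *)

Section Splits.
Variable R : realType.

Lemma sum_cells (T : finType) (d : T -> nat) (N : nat) (A : {set T})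
    (F : nat -> R) : (forall x, x \in A -> (d x < N)%N) ->
  \sum_(x in A) F (d x) = \sum_(j < N) #|(A :&: cell d j)%SET|%:R * F j.
Proof.
move=> dN.
transitivity (\sum_(x in A) \sum_(j < N) if d x == j then F j else 0).
  apply: eq_bigr => x xA; rewrite -big_mkcond /=.
  by rewrite (big_pred1 (Ordinal (dN x xA))).
rewrite exchange_big /=; apply: eq_bigr => j _.
rewrite -big_mkcondr /= (eq_bigl (mem (A :&: cell d j)%SET)); last first.
  by move=> x; rewrite !inE.
by rewrite sumr_const mulr_natl.
Qed.

Lemma card_cells (T : finType) (d : T -> nat) (N : nat) (A : {set T}) :
  (forall x, x \in A -> (d x < N)%N) ->
  #|A| = (\sum_(j < N) #|(A :&: cell d j)%SET|)%N.
Proof.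
move=> dN; apply/eqP; rewrite -(eqr_nat R) natr_sum; apply/eqP.
have := @sum_cells T d N A (fun=> 1) dN; rewrite sumr_const => ->.
by apply: eq_bigr => j _; rewrite mulr1.
Qed.

Variables (n : nat) (mu : 'I_n -> R) (d : 'I_n -> nat).
Hypothesis mud : forall x, mu x = 2 ^- d x.
Hypothesis mu_dist : is_distribution mu.

Lemma split_size (A : {set 'I_n}) : \sum_(x in A) mu x = 2^-1 ->
  (1 <= #|A| < n)%N.
Proof.
move=> EA; have [_ sum1] := mu_dist; apply/andP; split.
  rewrite lt0n cards_eq0; apply/eqP => A0; move: EA; rewrite A0 big_set0.
  by move/eqP; rewrite eq_sym invr_eq0 pnatr_eq0.
rewrite ltn_neqAle -[X in (_ <= X)%N]card_ord max_card andbT.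
apply/eqP => cA; have : A = [set: 'I_n]%SET.
  by apply/eqP; rewrite eqEcard finset.subsetT cardsT card_ord cA /=.
move=> AT; move: EA; rewrite AT.
rewrite (eq_bigl xpredT) ?sum1; last by move=> x; rewrite finset.in_setT.
by move/eqP; rewrite eq_sym invr_eq1 pnatr_eq1.
Qed.

Lemma rho_ge_size (i : nat) : (1 <= i < n)%N ->
  #|Spl mu i|%:R / 'C(n, i)%:R <= rho_Spl mu.
Proof.
move=> i1n; rewrite /rho_Spl.
by apply: (@le_bigmax_seq _ R _ _ 0 i xpredT
  (fun i => #|Spl mu i|%:R / 'C(n, i)%:R)) => //; rewrite mem_index_iota.
Qed.

Lemma rho_ge_counts (a : nat -> nat) (N : nat) :
  (forall j, (j < N)%N -> (a j <= #|cell d j|)%N) ->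
  \sum_(j < N) (a j)%:R * 2 ^- j = 2^-1 :> R ->
  (\prod_(j < N) 'C(#|cell d j|, a j))%:R / 'C(n, \sum_(j < N) a j)%:R
    <= rho_Spl mu.
Proof.
move=> aN a12; rewrite -card_with_counts.
have sub A : A \in with_counts d a N ->
    (#|A| = \sum_(j < N) a j)%N /\ \sum_(x in A) mu x = 2^-1.
  rewrite inE => /andP[/fintype.subsetP AN /forallP cA].
  have dN x : x \in A -> (d x < N)%N by move=> /AN; rewrite inE.
  split.
    by rewrite (card_cells dN); apply: eq_bigr => j _; rewrite (eqP (cA j)).
  under eq_bigr do rewrite mud.
  rewrite (sum_cells (fun j => 2 ^- j) dN) -a12.
  by apply: eq_bigr => j _; rewrite (eqP (cA j)).
have [A0 A0in] : exists A0, A0 \in with_counts d a N.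
  apply/card_gt0P; rewrite card_with_counts prodn_gt0 // => j.
  by rewrite bin_gt0 aN.
have [sA0 mA0] := sub _ A0in.
have := split_size mA0; rewrite sA0 => i1n.
apply: le_trans (rho_ge_size i1n).
rewrite ler_pM2r ?invr_gt0 ?ltr0n ?bin_gt0; last by case/andP: i1n => _ /ltnW.
rewrite ler_nat; apply: subset_leq_card; apply/fintype.subsetP => A /sub[cA mA].
by rewrite inE cA eqxx mA eqxx.
Qed.

End Splits.

(** * Restoring the exact mass, first over the reals and then over the integers *)

Section Adjust.
Variable R : realType.

(** Dividing by [w] reduces this to the modulus of [h], the ratio moving by at most [nu]. The factor
    [w] on the right makes the errors add up to one modulus, however many depths there are. *)
Lemma phi_shift (w z nu : R) : 0 <= z <= w -> 0 <= nu <= 1 ->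
  `|phi w (z + nu * (w - z)) - phi w z| <= w * (12 * Num.sqrt nu).
Proof.
move=> /andP[z0 zw] nu01; have := le_trans z0 zw.
rewrite le_eqVlt => /predU1P[w0|w0].
  have -> : z = 0 by lra.
  by rewrite -w0 !(mul0r, subr0, mulr0, addr0) subrr normr0.
have Ez : z = w * (z / w) by rewrite mulrCA divff ?mulr1 ?gt_eqF.
set x := z / w in Ez.
have x01 : 0 <= x <= 1 by rewrite divr_ge0 ?(ltW w0) //= ler_pdivrMr // mul1r.
have -> : z + nu * (w - z) = w * (x + nu * (1 - x)) by rewrite Ez; ring.
move: x01 nu01 => /andP[x0 x1] /andP[n0 n1].
have x01' : 0 <= x + nu * (1 - x) <= 1 by apply/andP; split; nra.
have x01 : 0 <= x <= 1 by rewrite x0.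
rewrite Ez !phi_h ?(ltW w0) // -mulrBr normrM gtr0_norm // ler_pM2l //.
apply: h_uc => //; rewrite addrAC subrr add0r ger0_norm ?mulr_ge0 ?subr_ge0 //.
by rewrite ler_piMr // gerBl.
Qed.

Variables (I : Type) (r : seq I) (Q : pred I) (w z g : I -> R).
Hypothesis zw : forall i, Q i -> 0 <= z i <= w i.
Hypothesis w1 : \sum_(i <- r | Q i) w i <= 1.
Hypothesis g0 : forall i, Q i -> 0 <= g i.

(* Scaling down is free by [phi_scale]; scaling up costs only the modulus of
   continuity, because the deficit [tau] is small. *)
Lemma phi_adjust (t tau : R) : 0 <= t -> 0 <= tau <= 4^-1 ->
  t - tau <= \sum_(i <- r | Q i) z i * g i ->
  t + 4^-1 <= \sum_(i <- r | Q i) w i * g i ->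
  exists z' : I -> R, [/\ forall i, Q i -> 0 <= z' i <= w i,
    \sum_(i <- r | Q i) z' i * g i = t &
    \sum_(i <- r | Q i) phi (w i) (z i) - h (\sum_(i <- r | Q i) z i)
      - 24 * Num.sqrt (4 * tau) <=
    \sum_(i <- r | Q i) phi (w i) (z' i) - h (\sum_(i <- r | Q i) z' i)].
Proof.
move=> t0 tau01; set L := \sum_(i <- r | Q i) z i * g i.
set V := \sum_(i <- r | Q i) w i * g i => tL tV.
have L0 : 0 <= L.
  by apply: sumr_ge0 => i Qi; rewrite mulr_ge0 ?g0 //; case/andP: (zw Qi).
have s0 : 0 <= Num.sqrt (4 * tau) by exact: sqrtr_ge0.
have [tL'|Lt] := leP t L.
- have [lam lam01 lamE] : exists2 lam, 0 <= lam <= 1 & lam * L = t.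
    move: L0; rewrite le_eqVlt => /predU1P[L0|L0].
      by exists 1; [lra | rewrite mul1r; lra].
    exists (t / L); last by rewrite divfK // gt_eqF.
    by rewrite divr_ge0 ?(ltW L0) //= ler_pdivrMr // mul1r.
  exists (fun i => lam * z i); split.
  + move=> i /zw /andP[z0 zwi]; case/andP: lam01 => l0 l1.
    by rewrite mulr_ge0 //= (le_trans _ zwi) // ler_piMl.
  + by rewrite -lamE mulr_sumr; apply: eq_bigr => i _; rewrite mulrA.
  + by have := phi_scale zw w1 lam01; rewrite -mulr_sumr; lra.
have VL : 4^-1 < V - L by lra.
have VL0 : 0 < V - L by apply: lt_trans VL; lra.
(* Moving every [z i] the fraction [nu] of the way to [w i] raises the mass from [L] to [t]. As
   [V - L > 1/4] and [t - L <= tau], this fraction is at most [4 * tau]. *)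
pose nu := (t - L) / (V - L).
have nu0 : 0 <= nu by rewrite divr_ge0 ?ltW // subr_gt0.
have nut : nu <= 4 * tau.
  rewrite ler_pdivrMr //; have : tau * 4^-1 <= tau * (V - L).
    by rewrite ler_wpM2l ?(ltW VL) //; case/andP: tau01.
  lra.
have nu01 : 0 <= nu <= 1 by rewrite nu0 /=; lra.
exists (fun i => z i + nu * (w i - z i)); split.
- move=> i /zw /andP[z0 zwi]; case/andP: nu01 => n0 n1.
  by apply/andP; split; nra.
- transitivity (L + nu * (V - L)); last by rewrite divfK ?gt_eqF //; ring.
  rewrite /L /V -sumrB mulr_sumr -big_split /=.
  by apply: eq_bigr => i _; ring.
have sW : \sum_(i <- r | Q i) phi (w i) (z i) - 12 * Num.sqrt nu <=
    \sum_(i <- r | Q i) phi (w i) (z i + nu * (w i - z i)).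
  have : \sum_(i <- r | Q i) (phi (w i) (z i) - w i * (12 * Num.sqrt nu)) <=
      \sum_(i <- r | Q i) phi (w i) (z i + nu * (w i - z i)).
    apply: ler_sum => i Qi; have := phi_shift (zw Qi) nu01.
    by rewrite ler_norml => /andP[+ _]; lra.
  rewrite sumrB -mulr_suml; apply: le_trans; rewrite lerD2l lerN2.
  by rewrite ler_piMl // mulr_ge0 // sqrtr_ge0.
set Z := \sum_(i <- r | Q i) z i; set W := \sum_(i <- r | Q i) w i; have W1 : W <= 1 := w1.
have Z0 : 0 <= Z by apply: sumr_ge0 => i /zw /andP[].
have ZW : Z <= W by apply: ler_sum => i /zw /andP[].
have EZ : \sum_(i <- r | Q i) (z i + nu * (w i - z i)) = Z + nu * (W - Z).
  by rewrite big_split /= -mulr_sumr sumrB.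
rewrite EZ.
have sn : Num.sqrt nu <= Num.sqrt (4 * tau) by rewrite ler_wsqrtr.
have hh : `|h (Z + nu * (W - Z)) - h Z| <= 12 * Num.sqrt nu.
  have : 0 <= nu * (W - Z) <= nu.
    by rewrite mulr_ge0 ?subr_ge0 //= ler_piMr //; lra.
  move=> /andP[nW0 nW1].
  have nWZ : nu * (W - Z) <= W - Z.
    by rewrite ler_piMl ?subr_ge0 //; case/andP: nu01.
  apply: h_uc; [lra | lra |].
  by rewrite addrAC subrr add0r ger0_norm.
move: hh; rewrite ler_norml => /andP[_ hh]; lra.
Qed.

End Adjust.

(* Rounding the [j]-th entry to a multiple of [2 ^ j] makes the total defect an
   integer, which [dyadic_fill] can then distribute. *)
Lemma dyadic_round (R : realType) (L : nat) (m : nat -> nat) (x : nat -> R)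
    (D : nat) :
  (forall j, (j < L)%N -> 0 <= x j <= (m j)%:R) ->
  \sum_(j < L) x j * 2 ^- j = D%:R ->
  exists a : nat -> nat, [/\ forall j, (j < L)%N -> (a j <= m j)%N,
    \sum_(j < L) (a j)%:R * 2 ^- j = D%:R :> R &
    forall j, (j < L)%N -> `|(a j)%:R - x j| <= (2 ^ L * L.+1)%:R].
Proof.
move=> xm xD.
have p0 j : 0 < (2 : R) ^+ j by rewrite exprn_gt0.
pose f j := Num.truncn (x j * 2 ^- j).
pose a0 j := (f j * 2 ^ j)%N.
have x0 j : (j < L)%N -> 0 <= x j * 2 ^- j.
  by move=> /xm /andP[? _]; rewrite divr_ge0 // ltW.
have fx j : (j < L)%N -> (f j)%:R <= x j * 2 ^- j < (f j).+1%:R.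
  by move=> jL; rewrite truncn_itv // x0.
have a0x j : (j < L)%N -> (a0 j)%:R <= x j.
  by move=> jL; case/andP: (fx j jL) => + _; rewrite ler_pdivlMr // natrM natrX.
have xa0 j : (j < L)%N -> x j <= (a0 j)%:R + 2 ^+ j.
  move=> jL; case/andP: (fx j jL) => _ /ltW; rewrite ler_pdivrMr //.
  by rewrite natrM natrX -[(f j).+1%:R]natr1 mulrDl mul1r.
have a0m j : (j < L)%N -> (a0 j <= m j)%N.
  by move=> jL; rewrite -(ler_nat R) (le_trans (a0x j jL)) //; case/andP: (xm j jL).
have fD : (\sum_(j < L) f j <= D)%N.
  rewrite -(ler_nat R) -xD natr_sum; apply: ler_sum => j _.
  by case/andP: (fx j (ltn_ord j)).
(* Each of the [L] truncations loses less than one unit of mass. *)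
have Df : (D - \sum_(j < L) f j <= L)%N.
  rewrite leq_subLR -(ler_nat R) natrD natr_sum -xD.
  have -> : L%:R = \sum_(j < L) 1 :> R by rewrite sumr_const card_ord.
  rewrite -big_split /=; apply: ler_sum => j _; case/andP: (fx j (ltn_ord j)) => _ /ltW.
  by rewrite natr1.
have mulp (u : nat -> nat) : (\sum_(j < L) u j * 2 ^ (L - j))%N%:R =
    (\sum_(j < L) (u j)%:R * 2 ^- j) * 2 ^+ L :> R.
  rewrite natr_sum mulr_suml; apply: eq_bigr => j _.
  rewrite natrM natrX -mulrA; congr (_ * _).
  by rewrite expfB_cond ?pnatr_eq0 ?(ltnW (ltn_ord j)) // mulrC.
have sa0 : \sum_(j < L) (a0 j)%:R * 2 ^- j = \sum_(j < L) (f j)%:R :> R.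
  by apply: eq_bigr => j _; rewrite natrM natrX mulfK // gt_eqF.
have [|e em eE] := @dyadic_fill L (fun j => m j - a0 j)%N (D - \sum_(j < L) f j).
  rewrite -(ler_nat R) (mulp (fun j => m j - a0 j)%N) natrM natrX ler_pM2r // natrB // natr_sum -xD -sa0.
  rewrite -sumrB; apply: ler_sum => j _; rewrite -mulrBl ler_pM2r ?invr_gt0 //.
  by rewrite natrB ?a0m // lerD2r; case/andP: (xm j (ltn_ord j)).
exists (fun j => a0 j + e j)%N; split.
- by move=> j jL; have := em j; have := a0m j jL; lia.
- have E1 : \sum_(j < L) (e j)%:R * 2 ^- j = D%:R - \sum_(j < L) (f j)%:R :> R.
    apply: (@mulIf _ (2 ^+ L)); first by rewrite gt_eqF.
    by rewrite -mulp eE natrM natrX natrB // natr_sum.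
  rewrite (eq_bigr (fun j : 'I_L => (a0 j)%:R * 2 ^- j + (e j)%:R * 2 ^- j)).
    by rewrite big_split /= E1 sa0 addrC subrK.
  by move=> j _; rewrite natrD mulrDl.
- move=> j jL.
  (* The filling weighs at most [L] units and a piece at depth [j] at least [2 ^- L] of a unit. With
     the truncation loss of at most [2 ^ j <= 2 ^ L] this gives the factor [L + 1]. *)
  have eL : (e j <= 2 ^ L * L)%N.
    apply: leq_trans (_ : (D - \sum_(j < L) f j) * 2 ^ L <= _)%N; last first.
      by rewrite mulnC leq_mul2l Df orbT.
    rewrite -eE (bigD1 (Ordinal jL)) //= (leq_trans _ (leq_addr _ _)) //.
    by rewrite leq_pmulr // expn_gt0.
  have qL : (2 ^ j <= 2 ^ L)%N by rewrite leq_exp2l // ltnW.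
  have eL' : (e j)%:R <= (2 ^ L * L)%:R :> R by rewrite ler_nat.
  have qL' : 2 ^+ j <= (2 ^ L)%:R :> R by rewrite -natrX ler_nat.
  have := a0x j jL; have := xa0 j jL.
  have n1 : 0 <= (2 ^ L * L)%:R :> R by rewrite ler0n.
  have n2 : 0 <= (e j)%:R :> R by rewrite ler0n.
  have n3 := p0 j.
  rewrite mulnS !natrD ler_norml => ? ?; apply/andP; split; lra.
Qed.

(** * Lower bound for an arbitrary admissible distribution *)

Section Lower.
Variables (R : realType) (beta : R).
Hypothesis hbeta : 1 <= beta < 2.

Let beta0 : 0 < beta.
Proof. by case/andP: hbeta => b1 _; exact: lt_le_trans b1. Qed.

Lemma sqrt_le_scale (a x kappa : R) : 0 <= a -> 0 <= kappa ->
  x <= a ^+ 2 * kappa -> Num.sqrt x <= a * Num.sqrt kappa.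
Proof.
move=> a0 k0 H; apply: (le_trans (ler_wsqrtr H)).
by rewrite sqrtrM ?exprn_ge0 // sqrtr_sqr ger0_norm.
Qed.

Lemma h_le_sqrt (x t : R) : 0 <= x <= 1 -> x <= t -> h x <= 12 * Num.sqrt t.
Proof.
move=> x01 xt; have z01 : 0 <= (0 : R) <= 1 by lra.
have xt' : `|x - 0| <= t by rewrite subr0 ger0_norm //; case/andP: x01.
have := h_uc x01 z01 xt'; rewrite h0 subr0 ler_norml; lra.
Qed.

Lemma dyadic_exponent n (mu : 'I_n -> R) : dyadic mu -> full_support mu ->
  ~ constant_distribution mu ->
  exists d : 'I_n -> nat, forall x, (0 < d x)%N /\ mu x = 2 ^- d x.
Proof.
move=> dy fs nc.
have H x : exists e : nat, (0 < e)%N /\ mu x = 2 ^- e.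
  have [mu0|[e me]] := dy x; first by have := fs x; rewrite mu0 eqxx.
  exists e; split=> //; rewrite lt0n; apply/eqP => e0.
  by apply: nc; exists x; rewrite me e0 expr0 invr1.
by have [d dP] := choice H; exists d.
Qed.

Lemma sum_split3 (H L T : nat) (F : nat -> R) :
  \sum_(i < H + L + T) F i =
  \sum_(i < H) F i + \sum_(j < L) F (H + j)%N + \sum_(t < T) F (H + L + t)%N.
Proof. by rewrite !big_split_ord /=. Qed.

Lemma sum_split2 (H L : nat) (F : nat -> R) :
  \sum_(i < H + L) F i = \sum_(i < H) F i + \sum_(j < L) F (H + j)%N.
Proof. by rewrite big_split_ord /=. Qed.

Lemma sum_recl (N : nat) (F : nat -> R) : (0 < N)%N ->
  \sum_(j < N) F j = F 0%N + \sum_(j < N.-1) F j.+1.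
Proof. by case: N => // N _; rewrite big_ord_recl. Qed.

Lemma sum_bump (K k : nat) (F u : nat -> R) (x : R) : (k < K)%N ->
  \sum_(i < K) F i * (u i + (if i == k :> nat then x else 0)) =
  \sum_(i < K) F i * u i + F k * x.
Proof.
move=> kK.
under eq_bigr do rewrite mulrDr.
rewrite big_split /=; congr (_ + _).
rewrite (bigD1 (Ordinal kK)) //= eqxx big1 ?addr0 // => i ik.
by rewrite ifN ?mulr0.
Qed.

Variables (n k s : nat) (mu : 'I_n -> R) (d : 'I_n -> nat).
Hypothesis hn : n%:R = beta * 2 ^+ k.
Hypothesis mud : forall x, mu x = 2 ^- d x.
Hypothesis d0 : forall x, (0 < d x)%N.
Hypothesis mu_dist : is_distribution mu.

Let m j := #|cell d j|.

Let n0 : 0 < n%:R :> R.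
Proof. by rewrite hn mulr_gt0 ?exprn_gt0. Qed.

Let mn j : (m j <= n)%N.
Proof. by rewrite -[X in (_ <= X)%N]card_ord max_card. Qed.

Lemma rho_log_ge (a : nat -> nat) (N : nat) :
  (forall j, (j < N)%N -> (a j <= m j)%N) ->
  \sum_(j < N) (a j)%:R * 2 ^- j = 2^-1 :> R ->
  let S := \sum_(j < N) (a j)%:R in
  [/\ 0 < rho_Spl mu, 0 <= S / n%:R <= 1 &
   \sum_(j < N) log2 'C(m j, a j)%:R - n%:R * h (S / n%:R) <=
     log2 (rho_Spl mu)].
Proof.
move=> am a12 S.
have ES : S = (\sum_(j < N) a j)%:R by rewrite natr_sum.
have Sn : (\sum_(j < N) a j <= n)%N.
  apply: leq_trans (_ : \sum_(j < N) m j <= _)%N.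
    by apply: leq_sum => j _; exact: am.
  rewrite -(ler_nat R) natr_sum.
  have := @sum_cells R 'I_n d N [set x | (d x < N)%N]%SET (fun=> 1).
  rewrite sumr_const => E; apply: le_trans (_ : #|[set x | (d x < N)%N]%SET|%:R <= _); last first.
    by rewrite ler_nat -[X in (_ <= X)%N]card_ord max_card.
  rewrite E; last by move=> x; rewrite inE.
  apply: ler_sum => j _; rewrite mulr1 ler_nat subset_leq_card //.
  by apply/fintype.subsetP => x; rewrite !inE => /eqP ->; rewrite eqxx ltn_ord.
have C0 : 0 < 'C(n, \sum_(j < N) a j)%:R :> R by rewrite ltr0n bin_gt0.
have P0 : (0 < \prod_(j < N) 'C(m j, a j))%N.
  by rewrite prodn_gt0 // => j; rewrite bin_gt0 am.
have r0 : 0 < (\prod_(j < N) 'C(m j, a j))%:R / 'C(n, \sum_(j < N) a j)%:R :> R.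
  by rewrite divr_gt0 // ltr0n.
have rge := rho_ge_counts mud mu_dist am a12.
have S01 : 0 <= S / n%:R <= 1.
  by rewrite ES divr_ge0 ?ler0n //= ler_pdivrMr // mul1r ler_nat.
split=> //; first exact: lt_le_trans r0 rge.
apply: le_trans (le_log2 r0 rge).
rewrite log2M ?ltr0n ?invr_gt0 // log2V // lerB //.
  by rewrite log2_nat_prod // => j _; rewrite bin_gt0 am.
have /andP[_ H] := log2_bin R Sn; apply: le_trans H _.
by rewrite -phi_h ?ler0n // ES mulrCA divff ?mulr1 // gt_eqF.
Qed.

(** A bound that exceeds every depth, so that the shallow depths below [H], the window of [L] depths
    from [k - s] to [k + s - 1], and [T] deep ones exhaust all atoms. *)
Let T := (\sum_x d x).+1.
Let H := (k - s)%N.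
Let L := (2 * s)%N.
Hypothesis s3 : (3 <= s)%N.
Hypothesis sk : (s < k)%N.

(** The scale of what is neglected: the fraction of shallow atoms and, up to a factor 2, the mass of
    deep atoms. Through the modulus of continuity it enters the entropies as [sigma]. *)
Let kappa : R := 2 ^- s.
Let sigma : R := Num.sqrt kappa.

Let dT x : (d x < H + L + T)%N.
Proof.
by rewrite /T addnS ltnS (leq_trans _ (leq_addl _ _)) // (bigD1 x) //= leq_addr.
Qed.

Let cell_sum (F : nat -> R) :
  \sum_(j < H + L + T) (m j)%:R * F j = \sum_x F (d x).
Proof.
transitivity (\sum_(x in [set: 'I_n]%SET) F (d x)).
  rewrite (sum_cells F (N := H + L + T)) //.
  by apply: eq_bigr => j _; rewrite finset.setTI.
by apply: eq_bigl => x; rewrite finset.in_setT.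
Qed.

Let nH : R := \sum_(j < H) (m j)%:R.
Let nL : R := \sum_(j < L) (m (H + j))%:R.
Let nT : R := \sum_(t < T) (m (H + L + t))%:R.
Let om : R := \sum_(j < H) (m j)%:R * 2 ^- j.
Let ml : R := \sum_(j < L) (m (H + j))%:R * 2 ^- (H + j).
Let tau : R := \sum_(t < T) (m (H + L + t))%:R * 2 ^- (H + L + t).

Let count3 : nH + nL + nT = n%:R.
Proof.
rewrite /nH /nL /nT -(sum_split3 H L T (fun j => (m j)%:R)).
transitivity (\sum_(j < H + L + T) (m j)%:R * 1 : R).
  by apply: eq_bigr => j _; rewrite mulr1.
by rewrite (cell_sum (fun=> 1)) sumr_const card_ord.
Qed.

Let mass3 : om + ml + tau = 1.
Proof.
rewrite /om /ml /tau -(sum_split3 H L T (fun j => (m j)%:R * 2 ^- j)).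
rewrite (cell_sum (fun j => 2 ^- j)).
transitivity (\sum_x mu x); last by case: mu_dist.
by apply: eq_bigr => x _; rewrite mud.
Qed.

Let p0 j : 0 < (2 : R) ^+ j. Proof. by rewrite exprn_gt0. Qed.

Let ler_2V i j : (i <= j)%N -> 2 ^- j <= 2 ^- i :> R.
Proof. by move=> ij; rewrite lef_pV2 ?posrE // ler_weXn2l // ler1n. Qed.

Let kappa0 : 0 < kappa. Proof. by rewrite invr_gt0. Qed.

Let kn : kappa * n%:R = beta * 2 ^+ H.
Proof.
rewrite /kappa /H hn; have -> : 2 ^+ k = 2 ^+ (k - s) * 2 ^+ s :> R.
  by rewrite -exprD subnK // ltnW.
by field; rewrite gt_eqF.
Qed.

Let om0 : 0 <= om. Proof. by apply: sumr_ge0 => j _; rewrite divr_ge0 ?ler0n ?ltW. Qed.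
Let ml0 : 0 <= ml. Proof. by apply: sumr_ge0 => j _; rewrite divr_ge0 ?ler0n ?ltW. Qed.
Let tau0 : 0 <= tau. Proof. by apply: sumr_ge0 => j _; rewrite divr_ge0 ?ler0n ?ltW. Qed.
Let nH0 : 0 <= nH. Proof. by apply: sumr_ge0 => j _; rewrite ler0n. Qed.
Let nL0 : 0 <= nL. Proof. by apply: sumr_ge0 => j _; rewrite ler0n. Qed.
Let nT0 : 0 <= nT. Proof. by apply: sumr_ge0 => j _; rewrite ler0n. Qed.

(** Each shallow atom has mass at least [2 ^- H] and the total mass is 1, so there are at most
    [2 ^ H <= beta * 2 ^ H] of them. *)
Let nH_le : nH <= kappa * n%:R.
Proof.
rewrite kn; apply: le_trans (_ : 2 ^+ H <= _); last first.
  by rewrite ler_peMl ?(ltW (p0 _)) //; case/andP: hbeta.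
rewrite -[leRHS]mul1r -ler_pdivrMr //; apply: le_trans (_ : om <= 1); last first.
  by move: mass3 om0 ml0 tau0; lra.
rewrite mulr_suml; apply: ler_sum => j _; rewrite ler_wpM2l ?ler0n //.
exact: ler_2V (ltnW (ltn_ord j)).
Qed.

Let tau_nT : tau <= nT * 2 ^- (H + L).
Proof.
rewrite mulr_suml; apply: ler_sum => t _; rewrite ler_wpM2l ?ler0n //.
by apply: ler_2V; rewrite leq_addr.
Qed.

Let HLks : (H + L = k + s)%N. Proof. by rewrite /H /L mul2n -addnn addnA subnK // ltnW. Qed.

Let tau_le : tau <= 2 * kappa.
Proof.
apply: (le_trans tau_nT); rewrite HLks.
apply: le_trans (_ : n%:R * 2 ^- (k + s) <= _).
  by rewrite ler_pM2r ?invr_gt0 //; move: count3 nH0 nL0 nT0; lra.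
rewrite hn exprD /kappa [leLHS](_ : _ = beta * 2 ^- s).
  by rewrite ler_pM2r ?invr_gt0 // ltW //; case/andP: hbeta.
by field; rewrite !gt_eqF.
Qed.

Let tau_count : tau / beta <= nT / n%:R.
Proof.
rewrite ler_pdivrMr //; apply: (le_trans tau_nT).
have -> : nT / n%:R * beta = nT * 2 ^- k.
  by rewrite hn; field; rewrite !gt_eqF.
by rewrite ler_wpM2l // ler_2V // HLks leq_addr.
Qed.

Let kappa_le8 : kappa <= 8^-1.
Proof.
have -> : 8^-1 = 2 ^- 3 :> R by congr (_^-1); ring.
exact: ler_2V.
Qed.

Let sigma0 : 0 <= sigma. Proof. exact: sqrtr_ge0. Qed.

(** Since [G beta <= 0], a single split of size at most [kappa * n] suffices: the binomial
    coefficient it is divided by is at most [2 ^ (n * h (S / n))], with [S / n <= kappa]. *)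
Lemma heavy_case : 2^-1 <= om ->
  0 < rho_Spl mu /\ n%:R * (G beta - 12 * sigma) <= log2 (rho_Spl mu).
Proof.
move=> om12.
have H0 : (0 < H)%N by rewrite subn_gt0.
have m0 : m 0%N = 0%N.
  apply/eqP; rewrite cards_eq0; apply/eqP/setP => x; rewrite !inE.
  by rewrite gtn_eqF.
have HE : H = H.-1.+1 by rewrite prednK.
have eH i : (H.-1 - i = H - i.+1)%N by rewrite [in RHS]HE subSS.
have pw (u : nat -> nat) : (\sum_(j < H.-1) u j * 2 ^ (H.-1 - j))%N%:R =
    2 ^+ H * \sum_(j < H.-1) (u j)%:R * 2 ^- j.+1 :> R.
  rewrite natr_sum mulr_sumr; apply: eq_bigr => j _.
  rewrite natrM natrX mulrCA; congr (_ * _).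
  by rewrite eH expfB_cond ?pnatr_eq0 //= (leq_trans (ltn_ord j)) ?leq_pred.
(* No atom has depth 0, so the levels are shifted by one; the unit of the filling is then mass 1/2,
   and one unit is wanted. *)
have [|e em eE] := @dyadic_fill H.-1 (fun j => m j.+1) 1.
  rewrite mul1n -(ler_nat R) (pw (fun j => m j.+1)) natrX.
  move: om12; rewrite /om (sum_recl (fun j => (m j)%:R * 2 ^- j)) //.
  rewrite m0 mul0r add0r => om12.
  have -> : 2 ^+ H.-1 = 2 ^+ H * 2^-1 :> R.
    by rewrite {2}HE exprSr mulfK // pnatr_eq0.
  by rewrite ler_pM2l.
pose a j := if j is j'.+1 then e j' else 0%N.
have am j : (j < H)%N -> (a j <= m j)%N by case: j => // j _; exact: em.
have a12 : \sum_(j < H) (a j)%:R * 2 ^- j = 2^-1 :> R.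
  rewrite (sum_recl (fun j => (a j)%:R * 2 ^- j)) //= mul0r add0r.
  apply: (@mulfI _ (2 ^+ H)); first by rewrite gt_eqF.
  rewrite -(pw e) eE mul1n natrX {2}HE exprSr mulfK // pnatr_eq0.
have [r0 S01] := rho_log_ge am a12.
set S := \sum_(j < H) _ in S01 * => rge.
split=> //; apply: le_trans rge.
have SnH : S / n%:R <= kappa.
  rewrite ler_pdivrMr //; apply: le_trans nH_le; apply: ler_sum => j _.
  by rewrite ler_nat am.
have hS := h_le_sqrt S01 SnH.
have lC : 0 <= \sum_(j < H) log2 'C(m j, a j)%:R :> R.
  apply: sumr_ge0 => j _; rewrite -(log2_1 R) le_log2 //.
  by rewrite ler1n bin_gt0 am.
have G0 : G beta <= 0 by apply: G_le0; case/andP: hbeta.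
have : n%:R * (G beta - 12 * sigma) <= n%:R * (- h (S / n%:R)).
  by rewrite ler_pM2l // /sigma; lra.
rewrite mulrN; lra.
Qed.

Let K := (H + L)%N.
Let w (j : nat) : R := (m j)%:R / n%:R.

(* The tail is lumped into mass at the typical depth [k]; since its elements
   are lighter than that, this does not increase the total count. *)
Let c (i : nat) : R :=
  if (i < K)%N then w i + (if i == k then tau / beta else 0) else 0.

Let w_ge0 j : 0 <= w j.
Proof. by rewrite divr_ge0 ?ler0n. Qed.

Let w_le1 j : w j <= 1.
Proof. by rewrite ler_pdivrMr // mul1r ler_nat. Qed.

Let kK : (k < K)%N.
Proof. by rewrite /K HLks -[X in (X < _)%N]addn0 ltn_add2l (leq_trans _ s3). Qed.

Let tb0 : 0 <= tau / beta. Proof. by rewrite divr_ge0 // ltW. Qed.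

Let sum_c (F : nat -> R) :
  \sum_(i < K) F i * c i =
  \sum_(i < H) F i * w i + \sum_(j < L) F (H + j)%N * w (H + j)%N +
  F k * (tau / beta).
Proof.
rewrite -(sum_split2 H L (fun i => F i * w i)) -sum_bump //.
by apply: eq_bigr => i _; rewrite /c ltn_ord.
Qed.

Let c_out i : (K <= i)%N -> c i = 0.
Proof. by move=> Ki; rewrite /c ltnNge Ki. Qed.

Let c_ge0 i : 0 <= c i.
Proof.
rewrite /c; case: ifP => // _; apply: addr_ge0; first exact: w_ge0.
by case: ifP.
Qed.

Let sum_w_H : \sum_(i < H) w i = nH / n%:R.
Proof. by rewrite -mulr_suml. Qed.

Let sum_w_L : \sum_(j < L) w (H + j) = nL / n%:R.
Proof. by rewrite -mulr_suml. Qed.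

Let c_sum1 : \sum_(i < K) c i <= 1.
Proof.
have := sum_c (fun=> 1); under eq_bigr do rewrite mul1r.
under [X in _ = X + _ + _]eq_bigr do rewrite mul1r.
under [X in _ = _ + X + _]eq_bigr do rewrite mul1r.
rewrite mul1r sum_w_H sum_w_L => ->.
apply: le_trans (_ : nH / n%:R + nL / n%:R + nT / n%:R <= _).
  by rewrite lerD2l tau_count.
by rewrite -!mulrDl count3 divff // gt_eqF.
Qed.

(** With [b = k] the required value is [1 / n], because [n = beta * 2 ^ k]: the mass equation just
    says that the total mass is 1. The lump keeps its mass, as [2 ^- k * (tau / beta) = tau / n]. *)
Let c_calC : calC beta (c, k).
Proof.
have cle1 i : c i <= 1.
  have [iK|Ki] := ltnP i K; last by rewrite c_out.
  apply: le_trans c_sum1; rewrite (bigD1 (Ordinal iK)) //= lerDl.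
  by apply: sumr_ge0 => j _; exact: c_ge0.
split.
- by move=> i; rewrite c_ge0 cle1.
- rewrite (@lim_finite_series _ _ K); last by move=> i /c_out ->; rewrite mul0r.
  under eq_bigr do rewrite mulrC.
  rewrite (sum_c (fun i => 2 ^- i)) -hn.
  have -> : \sum_(i < H) 2 ^- i * w i = om / n%:R.
    by rewrite mulr_suml; apply: eq_bigr => i _; rewrite mulrCA mulrA.
  have -> : \sum_(j < L) 2 ^- (H + j) * w (H + j)%N = ml / n%:R.
    by rewrite mulr_suml; apply: eq_bigr => i _; rewrite mulrCA mulrA.
  have -> : 2 ^- k * (tau / beta) = tau / n%:R.
    by rewrite hn; field; rewrite !gt_eqF.
  by rewrite -!mulrDl mass3 div1r.
- by apply/cvg_ex; eexists; exact: (finite_series_cvg c_out).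
- by rewrite (lim_finite_series c_out) c_sum1.
Qed.

(** Applied to [alpha] and to [h] of [alpha], it bounds what is lost by keeping only the window:
    [kappa] for the shallow depths and [2 * kappa] for the lump. *)
Let shift_mass (f : nat -> R) : (forall i, 0 <= f i <= 1) ->
  0 <= \sum_(i < H) f i * w i + f k * (tau / beta) <= 3 * kappa.
Proof.
move=> f01; have f0 i : 0 <= f i by case/andP: (f01 i).
have f1 i : f i <= 1 by case/andP: (f01 i).
apply/andP; split.
  by apply: addr_ge0; [apply: sumr_ge0 => i _ |]; rewrite mulr_ge0.
have h1 : \sum_(i < H) f i * w i <= kappa.
  apply: le_trans (_ : nH / n%:R <= _); last by rewrite ler_pdivrMr.
  by rewrite -sum_w_H; apply: ler_sum => i _; rewrite ler_piMl.
have h2 : f k * (tau / beta) <= 2 * kappa.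
  apply: le_trans (_ : tau / beta <= _); first by rewrite ler_piMl.
  rewrite ler_pdivrMr //; apply: (le_trans tau_le).
  by rewrite ler_peMr ?mulr_ge0 ?(ltW kappa0) //; case/andP: hbeta.
lra.
Qed.

(** States that [n] is large in terms of [s]. The quantity [2 ^ L * L.+1] is the rounding error of
    [dyadic_round]; the factor [s ^ 2] keeps the rounding and logarithmic errors of order [sigma]
    after summation over the [2 * s] depths of the window. *)
Hypothesis sE : (s ^ 2 * (2 ^ L * L.+1))%:R <= kappa * n%:R :> R.

Lemma light_case (eps : R) : om < 2^-1 -> 0 < eps ->
  0 < rho_Spl mu /\
  n%:R * (G beta - eps - 163 * sigma) <= log2 (rho_Spl mu).
Proof.
move=> om12 eps0; have b1 : 1 <= beta by case/andP: hbeta.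
have [alpha [a01 aM] GP] := G_witness b1 eps0 c_calC.
rewrite (P_finite alpha c_out) (sum_c (fun i => h (alpha i))) (sum_c alpha) in GP.
pose z j := alpha (H + j)%N * w (H + j)%N.
pose wL j := w (H + j)%N.
have zw j : 0 <= z j <= wL j.
  by have /andP[? ?] := a01 (H + j)%N; rewrite mulr_ge0 //= ler_piMl.
pose Z := \sum_(j < L) z j.
pose Pz := \sum_(j < L) phi (wL j) (z j).
have EPz : \sum_(j < L) h (alpha (H + j)%N) * w (H + j)%N = Pz.
  by apply: eq_bigr => j _; rewrite /z mulrC -phi_h // mulrC.
rewrite EPz -/Z in GP.
have h01' i : 0 <= h (alpha i) <= 1 by rewrite h_ge0 ?h_le1.
have hz := shift_mass a01; have hh := shift_mass h01'.
have lx : Z <= nL / n%:R.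
  by rewrite -sum_w_L; apply: ler_sum => j _; case/andP: (zw j).
have Z0 : 0 <= Z by apply: sumr_ge0 => j _; case/andP: (zw j).
have nLn : nL / n%:R <= 1.
  by rewrite ler_pdivrMr // mul1r; move: count3 nH0 nT0; lra.
set zz := \sum_(i < H) alpha i * w i in GP hz.
set tk := alpha k * _ in GP hz.
have A01 : 0 <= zz + Z + tk <= 1.
  have := sum_c alpha; rewrite -/zz -/tk -/Z => <-.
  apply/andP; split.
    by apply: sumr_ge0 => i _; rewrite mulr_ge0 //; case/andP: (a01 i).
  apply: le_trans c_sum1; apply: ler_sum => i _.
  by rewrite ler_piMl //; case/andP: (a01 i).
have Z01 : 0 <= Z <= 1 by lra.
have claimA : G beta - eps - 3 * kappa - 24 * sigma <= Pz - h Z.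
  have d3 : `|zz + Z + tk - Z| <= 3 * kappa by rewrite ger0_norm; lra.
  have := h_uc A01 Z01 d3.
  have s2 : Num.sqrt (3 * kappa) <= 2 * sigma.
    by apply: sqrt_le_scale; rewrite ?(ltW kappa0) //; move: kappa0; lra.
  rewrite ler_norml => /andP[hu _].
  set p1 := \sum_(i < H) _ in GP hh; set p2 := h (alpha k) * _ in GP hh.
  move: GP hh hu s2; lra.
pose g j := n%:R * 2 ^- (H + j) : R.
have wg : \sum_(j < L) wL j * g j = ml.
  apply: eq_bigr => j _; rewrite /wL /w /g mulrA divfK ?gt_eqF //.
(* Under [alpha] the shallow depths carry at most [om] and the lump at most [tau], so the window
   carries the rest of 1/2. *)
have zg : 2^-1 - om - tau <= \sum_(j < L) z j * g j.
  move: aM; rewrite (@lim_finite_series _ _ K); last first.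
    by move=> i /c_out ->; rewrite mulr0 mul0r.
  under eq_bigr do rewrite mulrAC.
  have -> : (beta * 2 ^+ k.+1)^-1 = 2^-1 / n%:R.
    by rewrite hn exprS; field; rewrite !gt_eqF.
  rewrite (sum_c (fun i => alpha i / 2 ^+ i)).
  move/(congr1 (fun x => x * n%:R)); rewrite divfK ?gt_eqF // !mulrDl => <-.
  have -> : (\sum_(j < L) alpha (H + j)%N / 2 ^+ (H + j) * w (H + j)%N) * n%:R =
      \sum_(j < L) z j * g j.
    by rewrite mulr_suml; apply: eq_bigr => j _; rewrite /z /g; ring.
  have : (\sum_(i < H) alpha i / 2 ^+ i * w i) * n%:R <= om.
    rewrite mulr_suml; apply: ler_sum => i _; have /andP[? ?] := a01 i.
    rewrite [leLHS](_ : _ = alpha i * ((m i)%:R * 2 ^- i)); last first.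
      by rewrite /w; field; rewrite !gt_eqF.
    by apply: ler_piMl => //; rewrite divr_ge0 ?ler0n ?(ltW (p0 _)).
  have : alpha k / 2 ^+ k * (tau / beta) * n%:R <= tau.
    rewrite hn [leLHS](_ : _ = alpha k * tau); last by field; rewrite !gt_eqF.
    by rewrite ler_piMl //; case/andP: (a01 k).
  lra.
(* With all shallow atoms inside, the window has to supply exactly [1/2 - om]. Its own mass
   [1 - om - tau] exceeds this by at least 1/4, as the adjustment requires. *)
have t0 : 0 <= 2^-1 - om by lra.
have tau4 : 0 <= tau <= 4^-1 by move: tau0 tau_le kappa_le8; lra.
have tV : 2^-1 - om + 4^-1 <= \sum_(j < L) wL j * g j.
  by rewrite wg; move: mass3 tau4; lra.
have sw1 : \sum_(0 <= j < L) wL j <= 1 by rewrite big_mkord sum_w_L.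
have g0 j : true -> 0 <= g j by rewrite mulr_ge0 ?ler0n // invr_ge0 ltW.
have [] := @phi_adjust R nat (index_iota 0 L) xpredT wL z g (fun j _ => zw j) sw1 g0
  (2^-1 - om) tau t0 tau4; rewrite ?big_mkord //.
move=> z' [z'w]; rewrite !big_mkord -/Pz -/Z => z't claimC.
have s8 : Num.sqrt (4 * tau) <= 3 * sigma.
  by apply: sqrt_le_scale; rewrite ?(ltW kappa0) //; move: kappa0 tau_le; lra.
set Z' := \sum_(j < L) z' j in claimC.
(* The mass still missing, in units of [2 ^- H]. It is an integer because shallow masses are
   multiples of this unit, and [om < 1/2] makes the subtraction a true one. *)
pose D := (2 ^ H.-1 - \sum_(j < H) m j * 2 ^ (H - j))%N.
have H0 : (0 < H)%N by rewrite subn_gt0.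
have omH : (\sum_(j < H) m j * 2 ^ (H - j))%N%:R = om * 2 ^+ H :> R.
  rewrite natr_sum mulr_suml; apply: eq_bigr => j _.
  rewrite natrM natrX -mulrA; congr (_ * _).
  by rewrite expfB_cond ?pnatr_eq0 ?(ltnW (ltn_ord j)) // mulrC.
have H1 : 2 ^+ H.-1 = 2^-1 * 2 ^+ H :> R.
  by rewrite -{2}(prednK H0) exprS mulrA mulVf ?mul1r // pnatr_eq0.
have DE : D%:R = (2^-1 - om) * 2 ^+ H :> R.
  rewrite natrB; first by rewrite omH natrX H1 -mulrBl.
  by rewrite -(ler_nat R) omH natrX H1 ler_pM2r // ltW.
have xm j : (j < L)%N -> 0 <= n%:R * z' j <= (m (H + j))%:R.
  move=> _; have /andP[z0 z1] := z'w j isT.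
  rewrite mulr_ge0 ?ler0n //= mulrC -ler_pdivlMr //.
have xD : \sum_(j < L) (n%:R * z' j) * 2 ^- j = D%:R.
  rewrite DE -z't mulr_suml; apply: eq_bigr => j _.
  by rewrite /g exprD; field; rewrite !gt_eqF.
have [a0 [a0m a0D a0x]] := dyadic_round xm xD.
pose a j := if (j < H)%N then m j else a0 (j - H)%N.
have aH j : (j < H)%N -> a j = m j by rewrite /a => ->.
have aL j : a (H + j)%N = a0 j by rewrite /a ltnNge leq_addr /= addKn.
have am j : (j < K)%N -> (a j <= m j)%N.
  move=> jK; rewrite /a; case: ltnP => // Hj.
  have jL : (j - H < L)%N by move: jK; rewrite -{1}(subnKC Hj) ltn_add2l.
  by have := a0m _ jL; rewrite (subnKC Hj).
have sum_a (F : nat -> nat -> R) : \sum_(j < K) F j (a j) =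
    \sum_(j < H) F j (m j) + \sum_(j < L) F (H + j)%N (a0 j).
  rewrite (sum_split2 H L (fun i => F i (a i))); congr (_ + _).
    by apply: eq_bigr => j _; rewrite aH.
  by apply: eq_bigr => j _; rewrite aL.
have a12 : \sum_(j < K) (a j)%:R * 2 ^- j = 2^-1 :> R.
  rewrite (sum_a (fun j x => x%:R * 2 ^- j)) -/om.
  have -> : \sum_(j < L) (a0 j)%:R * 2 ^- (H + j) = D%:R * 2 ^- H :> R.
    rewrite -a0D mulr_suml; apply: eq_bigr => j _.
    by rewrite exprD invfM; ring.
  by rewrite DE mulfK ?gt_eqF //; ring.
have [r0] := rho_log_ge am a12.
rewrite (sum_a (fun _ x => x%:R)) (sum_a (fun j x => log2 'C(m j, x)%:R)) -/nH.
set S := nH + _ => S01.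
(* Taking all shallow atoms leaves one choice there, hence no entropy. *)
rewrite big1; last by move=> j _; rewrite binn log2_1.
rewrite add0r => rge; split=> //; apply: le_trans rge.
set E := (2 ^ L * L.+1)%N in a0x.
have sE' : (s ^ 2 * E)%:R <= kappa * n%:R := sE.
pose del := E%:R / n%:R : R.
have E1 : (1 <= E)%N by rewrite muln_gt0 expn_gt0.
have s0 : 0 < s%:R :> R by rewrite ltr0n (leq_trans _ s3).
have sdel : s%:R * Num.sqrt del <= sigma.
  rewrite mulrC -ler_pdivlMr // mulrC; apply: sqrt_le_scale.
  - by rewrite invr_ge0 ltW.
  - exact: ltW.
  rewrite exprVn mulrC ler_pdivlMr ?exprn_gt0 // /del mulrAC ler_pdivrMr //.
  by move: sE'; rewrite natrM natrX mulrC.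
have Ldel : L%:R * del <= kappa.
  rewrite /del mulrA ler_pdivrMr //; apply: le_trans sE'; rewrite -natrM ler_nat.
  by rewrite leq_mul2r /L; apply/orP; right; rewrite expnS expn1 leq_mul2r ltnW ?orbT.
have sn : s%:R * Num.sqrt n%:R <= sigma * n%:R.
  have sq0 : 0 <= Num.sqrt n%:R :> R by exact: sqrtr_ge0.
  have s2 : s%:R ^+ 2 <= kappa * n%:R.
    by apply: le_trans sE'; rewrite -natrX ler_nat leq_pmulr.
  have : s%:R <= Num.sqrt (kappa * n%:R).
    by rewrite -[leLHS](ger0_norm (ltW s0)) -sqrtr_sqr ler_wsqrtr.
  rewrite sqrtrM ?(ltW kappa0) // -/sigma => H2.
  have En : n%:R = Num.sqrt n%:R * Num.sqrt n%:R :> R.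
    by rewrite -expr2 sqr_sqrtr // ltW.
  by rewrite [in leRHS]En mulrA ler_wpM2r.
have n1 : 1 <= n%:R :> R by rewrite ler1n -(ltr0n R).
have log_n j : log2 (m (H + j)).+1%:R <= 8 * Num.sqrt n%:R :> R.
  apply: le_trans (_ : log2 (n.+1)%:R <= _).
    by rewrite le_log2 ?ltr0n // ler_nat ltnS.
  apply: le_trans (log2_le_sqrt _) _; first by rewrite ler1n.
  have : Num.sqrt n.+1%:R <= 2 * Num.sqrt n%:R :> R.
    apply: sqrt_le_scale; rewrite ?ler0n // -natr1 expr2; lra.
  lra.
have near j : `|(a0 j)%:R / n%:R - z' j| <= del \/ ~ (j < L)%N.
  have [jL|] := ltnP j L; last by right.
  left; rewrite /del ler_pdivlMr // -{2}(gtr0_norm n0) -normrM mulrBl.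
  by rewrite divfK ?gt_eqF // [z' j * _]mulrC; exact: a0x.
have near' (j : 'I_L) : `|(a0 j)%:R / n%:R - z' j| <= del.
  by case: (near j) => // /(_ (ltn_ord j)).
have a0n (j : 'I_L) : 0 <= ((a0 j)%:R / n%:R : R) <= wL j.
  by rewrite divr_ge0 ?ler0n //= ler_pM2r ?invr_gt0 // ler_nat a0m.
have dphi (j : 'I_L) : n%:R * (phi (wL j) (z' j) - 12 * Num.sqrt del) -
    8 * Num.sqrt n%:R <= log2 'C(m (H + j), a0 j)%:R.
  have /andP[lo _] := log2_bin R (a0m j (ltn_ord j)).
  apply: le_trans lo; apply: lerB (log_n j).
  have -> : phi (m (H + j))%:R (a0 j)%:R = n%:R * phi (wL j) ((a0 j)%:R / n%:R).
    rewrite -phiM ?ler0n // /wL /w.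
    by congr phi; field; rewrite gt_eqF.
  rewrite ler_pM2l //; have z'j := z'w j isT.
  by have := phi_uc (a0n j) z'j (w_le1 _) (near' j); rewrite ler_norml; lra.
have : \sum_(j < L) (n%:R * (phi (wL j) (z' j) - 12 * Num.sqrt del) -
    8 * Num.sqrt n%:R) <= \sum_(j < L) log2 'C(m (H + j), a0 j)%:R.
  by apply: ler_sum => j _; exact: dphi.
rewrite sumrB -mulr_sumr sumrB !sumr_const card_ord.
rewrite -[(12 * _) *+ L]mulr_natl -[(8 * _) *+ L]mulr_natl.
set Ph := \sum_(j < L) phi _ _ in claimC *; set Q := \sum_(j < L) log2 _ => PQ.
have Z'01 : 0 <= Z' <= 1.
  apply/andP; split; first by apply: sumr_ge0 => j _; case/andP: (z'w j isT).
  apply: le_trans nLn; rewrite -sum_w_L; apply: ler_sum => j _.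
  by case/andP: (z'w j isT).
have SZ : `|S / n%:R - Z'| <= 2 * kappa.
  have -> : S / n%:R - Z' =
      nH / n%:R + \sum_(j < L) ((a0 j)%:R / n%:R - z' j).
    by rewrite sumrB -mulr_suml /S mulrDl addrA.
  have q1 : `|\sum_(j < L) ((a0 j)%:R / n%:R - z' j)| <= L%:R * del.
    apply: (le_trans (ler_norm_sum _ _ _)).
    rewrite mulr_natl -[X in _ <= _ *+ X]card_ord -sumr_const.
    by apply: ler_sum => j _; exact: near'.
  have q2 : `|nH / n%:R| <= kappa.
    by rewrite ger0_norm ?divr_ge0 ?ler0n // ler_pdivrMr.
  by apply: (le_trans (ler_normD _ _)); lra.
have hS := h_uc S01 Z'01 SZ.
have s2 : Num.sqrt (2 * kappa) <= 2 * sigma.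
  by apply: sqrt_le_scale; rewrite ?(ltW kappa0) //; move: kappa0; lra.
have ks : kappa <= sigma.
  have -> : kappa = sigma * sigma by rewrite -expr2 sqr_sqrtr // ltW.
  by rewrite ler_piMl // -sqrtr1 ler_wsqrtr //; move: kappa_le8; lra.
have LE : L%:R = 2 * s%:R :> R by rewrite natrM.
have PQ' : n%:R * (Ph - 24 * sigma) - 16 * (sigma * n%:R) <= Q.
  apply: le_trans PQ; rewrite LE; apply: lerB.
    by rewrite ler_pM2l // lerB //; move: sdel; lra.
  by move: sn; lra.
(* In multiples of [sigma], 163 = 3 + 24 (restriction to the window, [claimA]) + 72 (mass
   adjustment, [claimC]) + 24 ([hS]) + 24 (rounding inside [phi]) + 16 (logarithms from the binomial
   bounds). *)
have : n%:R * (G beta - eps - 163 * sigma) <=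
    n%:R * (Ph - 24 * sigma - 16 * sigma - h (S / n%:R)).
  rewrite ler_pM2l //; move: hS claimA claimC s2 s8 ks; rewrite ler_norml.
  move=> /andP[_ hS]; lra.
move: PQ'; lra.
Qed.

Lemma rho_lower (eps : R) : 0 < eps ->
  0 < rho_Spl mu /\
  n%:R * (G beta - eps - 163 * sigma) <= log2 (rho_Spl mu).
Proof.
move=> e0; have [om12|om12] := ltP om 2^-1; first exact: light_case.
have [r0 rl] := heavy_case om12; split=> //; apply: le_trans rl.
by rewrite ler_pM2l //; move: sigma0; lra.
Qed.

End Lower.

(** * Upper bound: comparing one count vector with the supremum of [P] *)

Section UpperKey.
Variables (R : realType) (beta : R).
Hypothesis hbeta : 1 <= beta.
Variables (c : nat -> R) (b : nat).
Hypothesis C : calC beta (c, b).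

Let beta0 : 0 < beta. Proof. exact: lt_le_trans hbeta. Qed.
Let c01 i : 0 <= c i <= 1. Proof. by case: C. Qed.
Let c0 i : 0 <= c i. Proof. by case/andP: (c01 i). Qed.
Let cc : cvgn (series c). Proof. by case: C. Qed.
Let cT : limn (series c) <= 1. Proof. by case: C. Qed.

(** Beyond index [s] every weight is at most [2 ^- s]. The finitely supported [f] corrects the
    weights below [s], so that a termwise comparison of two series applies. *)
Lemma geom_tail_le s : (beta * 2 ^+ b)^-1 <=
  \sum_(i < s) c i / 2 ^+ i + 2 ^- s * (limn (series c) - \sum_(i < s) c i).
Proof.
have [_ <- _ _] := C.
pose f i := if (i < s)%N then (2 ^- i - 2 ^- s) * c i else 0.
have f0 i : (s <= i)%N -> f i = 0 by rewrite /f ltnNge => ->.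
have cf : cvgn (series f) by apply/cvg_ex; eexists; exact: (finite_series_cvg f0).
apply: le_trans (_ : limn (series (fun i => 2 ^- s * c i + 1 * f i)) <= _).
  apply: lim_series_le => [||i]; first exact: calC_geom_cvg C.
    by apply/cvg_ex; eexists; exact: (series_comb_cvg cc cf).
  rewrite /f; case: ltnP => si; first by rewrite le_eqVlt; apply/orP; left; apply/eqP; ring.
  rewrite mulr0 addr0 mulrC ler_wpM2r // lef_pV2 ?posrE ?exprn_gt0 //.
  by rewrite ler_weXn2l // ler1n.
rewrite lim_series_comb // (lim_finite_series f0) mul1r.
rewrite le_eqVlt; apply/orP; left; apply/eqP.
have -> : \sum_(i < s) f i = \sum_(i < s) c i / 2 ^+ i - 2 ^- s * \sum_(i < s) c i.
  rewrite mulr_sumr -sumrB; apply: eq_bigr => i _; rewrite /f ltn_ord; ring.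
ring.
Qed.

Let T : R := (beta * 2 ^+ b.+1)^-1.

(** The pair [ws], [ys] stands for the atoms at the last depth, which have no counterpart in [c].
    They contribute entropy at most [ws], and their mass and number are charged to the two square
    roots. *)
Lemma upper_key (M : R) (s : nat) (w y : nat -> R) (ws ys : R) :
  (forall alpha, calA beta c b alpha -> P c alpha <= M) ->
  (forall i, (i < s)%N -> 0 <= y i <= w i) ->
  (forall i, (i < s)%N -> w i <= c i) ->
  0 <= ys <= ws ->
  \sum_(i < s) y i / 2 ^+ i + ys / 2 ^+ s = T ->
  \sum_(i < s) y i + ys <= 1 ->
  \sum_(i < s) phi (w i) (y i) + phi ws ys - h (\sum_(i < s) y i + ys) <=
  M + ws + 12 * Num.sqrt (ws / T) + 12 * Num.sqrt (ws / T + ws).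
Proof.
move=> PM yw wc yws yT y1.
have T0 : 0 < T by rewrite invr_gt0 mulr_gt0 ?exprn_gt0.
have y0 i : (i < s)%N -> 0 <= y i by move/yw => /andP[].
have yc i : (i < s)%N -> y i <= c i.
  by move=> si; apply: le_trans (wc i si); case/andP: (yw i si).
pose e := ys / 2 ^+ s.
have [ys0 ysw] : 0 <= ys /\ ys <= ws by case/andP: yws.
have e0 : 0 <= e by rewrite divr_ge0 // exprn_ge0.
have ews : e <= ws.
  apply: le_trans ysw; rewrite ler_pdivrMr ?exprn_gt0 // ler_peMr //.
  by rewrite exprn_ege1 // ler1n.
(* The ratios [y i / c i] give mass [T - e] against [c], while the constant 1 gives [2 * T]. The
   mixture has mass [T] exactly when [nu * (T + e) = e]. *)
pose nu := e / (T + e).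
have Te0 : 0 < T + e by lra.
have nu01 : 0 <= nu <= 1.
  by rewrite divr_ge0 ?(ltW Te0) //= ler_pdivrMr // mul1r; lra.
have nuT : nu <= ws / T.
  rewrite ler_pdivrMr // mulrAC ler_pdivlMr //.
  have h1 : e * T <= ws * T by rewrite ler_pM2r.
  have h2 : 0 <= ws * e by rewrite mulr_ge0 // (le_trans ys0).
  lra.
pose x i := if (i < s)%N then y i / c i else 0.
have xout i : (s <= i)%N -> x i = 0 by rewrite /x ltnNge => ->.
have cx i : (i < s)%N -> x i * c i = y i.
  move=> si; rewrite /x si; have := c0 i; rewrite le_eqVlt => /predU1P[ci|ci].
    by have := y0 i si; have := yc i si; rewrite -ci mulr0; lra.
  by rewrite divfK // gt_eqF.
have x01 i : 0 <= x i <= 1.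
  rewrite /x; case: ltnP => si; last by rewrite lexx ler01.
  rewrite divr_ge0 ?y0 //=; have := c0 i; rewrite le_eqVlt => /predU1P[<-|ci].
    by rewrite invr0 mulr0.
  by rewrite ler_pdivrMr // mul1r yc.
pose alpha i := nu + (1 - nu) * x i.
have a01 i : 0 <= alpha i <= 1.
  have /andP[x0 x1] := x01 i; case/andP: nu01 => n0 n1.
  by rewrite /alpha; apply/andP; split; nra.
have nu1 : 1 - nu = T / (T + e) by rewrite /nu; field; rewrite gt_eqF.
have cg := calC_geom_cvg C.
have xo i : (s <= i)%N -> x i * c i = 0 by move/xout => ->; rewrite mul0r.
have xg i : (s <= i)%N -> x i * c i / 2 ^+ i = 0 by move/xo => ->; rewrite mul0r.
have cvx : cvgn (series (fun i => x i * c i)).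
  by apply/cvg_ex; eexists; exact: (finite_series_cvg xo).
have cvxg : cvgn (series (fun i => x i * c i / 2 ^+ i)).
  by apply/cvg_ex; eexists; exact: (finite_series_cvg xg).
have aA : calA beta c b alpha.
  split=> //; rewrite -/T.
  rewrite (_ : (fun i => _) =
    (fun i => nu * (c i / 2 ^+ i) + (1 - nu) * (x i * c i / 2 ^+ i))); last first.
    by apply/funext => i; rewrite /alpha; ring.
  rewrite lim_series_comb // (lim_finite_series xg).
  have -> : \sum_(i < s) x i * c i / 2 ^+ i = T - e.
    rewrite -yT /e addrK; apply: eq_bigr => i _; by rewrite cx.
  have [_ -> _ _] := C.
  have -> : (beta * 2 ^+ b)^-1 = 2 * T.
    by rewrite /T exprS; field; rewrite !gt_eqF ?exprn_gt0.
  by rewrite nu1 /nu; field; rewrite gt_eqF.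
have Y0 : 0 <= \sum_(i < s) y i by apply: sumr_ge0 => i _; exact: y0.
set Y := \sum_(i < s) y i in Y0 y1 *.
have aS : limn (series (fun i => alpha i * c i)) =
    nu * limn (series c) + (1 - nu) * Y.
  rewrite (_ : (fun i => _) = (fun i => nu * c i + (1 - nu) * (x i * c i))); last first.
    by apply/funext => i; rewrite /alpha; ring.
  rewrite lim_series_comb // (lim_finite_series xo).
  by congr (_ + _ * _); apply: eq_bigr => i _; rewrite cx.
have A01 := weighted_lim_bounds C a01.
have Yys01 : 0 <= Y + ys <= 1 by rewrite addr_ge0.
have YC : Y <= limn (series c).
  apply: le_trans (partial_sum_le_lim s c0 cc).
  by apply: ler_sum => i _; exact: yc.
have dY : `|nu * limn (series c) + (1 - nu) * Y - (Y + ys)| <= ws / T + ws.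
  have h1 : nu * (limn (series c) - Y) <= nu.
    by rewrite ler_piMr //; [case/andP: nu01 | move: cT Y0; lra].
  have h2 : 0 <= nu * (limn (series c) - Y).
    by rewrite mulr_ge0 ?subr_ge0 //; case/andP: nu01.
  rewrite (_ : _ - _ = nu * (limn (series c) - Y) - ys); last by ring.
  have h3 : 0 <= ws / T by apply: le_trans nuT; case/andP: nu01.
  rewrite ler_norml; apply/andP; split; lra.
have hY : h (nu * limn (series c) + (1 - nu) * Y) - h (Y + ys) <=
    12 * Num.sqrt (ws / T + ws).
  have A01' : 0 <= nu * limn (series c) + (1 - nu) * Y <= 1 by rewrite -aS.
  by have := h_uc A01' Yys01 dY; rewrite ler_norml => /andP[_].
have sn : Num.sqrt nu <= Num.sqrt (ws / T) by rewrite ler_wsqrtr.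
have hsum : \sum_(i < s) phi (w i) (y i) - 12 * Num.sqrt nu <=
    limn (series (fun i => h (alpha i) * c i)).
  have ha0 i : 0 <= h (alpha i) * c i by rewrite mulr_ge0 // h_ge0.
  apply: le_trans (partial_sum_le_lim s ha0 (weighted_cvg C (h01 a01))).
  have : \sum_(i < s) (phi (w i) (y i) - c i * (12 * Num.sqrt nu)) <=
      \sum_(i < s) h (alpha i) * c i.
    apply: ler_sum => i _; have si := ltn_ord i.
    have H1 := phi_mono (yw i si) (wc i si).
    have H2 : phi (c i) (y i) = c i * h (x i).
      by rewrite -phi_h // mulrC cx.
    have xa : `|x i - alpha i| <= nu.
      have /andP[x0 x1] := x01 i; case/andP: nu01 => n0 n1.
      rewrite /alpha (_ : _ - _ = - (nu * (1 - x i))); last by ring.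
      have p0 : 0 <= nu * (1 - x i) by rewrite mulr_ge0 // subr_ge0.
      by rewrite normrN (ger0_norm p0) ler_piMr // gerBl.
    have := h_uc (x01 i) (a01 i) xa; rewrite ler_norml => /andP[_ H3].
    have : c i * (h (x i) - h (alpha i)) <= c i * (12 * Num.sqrt nu).
      by rewrite ler_wpM2l.
    lra.
  rewrite sumrB -mulr_suml => H; apply: le_trans H; rewrite lerD2l lerN2.
  rewrite ler_piMl ?mulr_ge0 ?sqrtr_ge0 //.
  exact: le_trans (partial_sum_le_lim s c0 cc) cT.
have := PM _ aA; rewrite /P aS => HP.
have := phi_le yws; lra.
Qed.

End UpperKey.

(** * Distributions with prescribed counts and a block of tiny mass *)

Section Design.
Variable R : realType.

Lemma seq_exponents (n : nat) (l : seq nat) : size l = n ->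
  exists d : 'I_n -> nat, (forall j, #|cell d j| = count_mem j l) /\
    forall F : nat -> R, \sum_x F (d x) = \sum_(e <- l) F e.
Proof.
move=> sl; exists (fun x => nth 0%N l x); split.
  move=> j; rewrite -sum1_count -sum1_card (big_nth 0%N) sl big_mkord.
  by apply: eq_bigl => x; rewrite inE.
by move=> F; rewrite (big_nth 0%N) sl big_mkord.
Qed.

(** The exponents of repeated halving of mass [2 ^- D], with the last one doubled: [t + 1] atoms of
    total mass exactly [2 ^- D]. *)
Definition chain (D t : nat) : seq nat := rcons (iota D.+1 t) (D + t)%N.

Lemma size_chain D t : size (chain D t) = t.+1.
Proof. by rewrite size_rcons size_iota. Qed.

Lemma sum_chain D t : \sum_(e <- chain D t) 2 ^- e = 2 ^- D :> R.
Proof.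
rewrite /chain -cats1 big_cat big_seq1 /=; elim: t D => [|t IH] D.
  by rewrite big_nil add0r addn0.
rewrite [iota _ _]/= big_cons -addrA -addSnnS IH exprS invfM.
by rewrite -mulrDl; lra.
Qed.

Lemma chain_gt D t e : (0 < t)%N -> e \in chain D t -> (D < e)%N.
Proof.
move=> t0; rewrite mem_rcons inE => /predU1P[->|]; first lia.
by rewrite mem_iota => /andP[].
Qed.

(** The chain supplies the last [2 ^- (D0 + s)] of mass and brings the number of atoms to [n]. For
    [t > 0] it lies strictly deeper than [D0 + s], so it does not disturb the prescribed counts. *)
Lemma design (D0 s t n : nat) (m : nat -> nat) : (0 < t)%N ->
  (\sum_(i < s.+1) m i + t.+1)%N = n ->
  \sum_(i < s.+1) (m i)%:R * 2 ^- (D0 + i) + 2 ^- (D0 + s) = 1 :> R ->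
  exists d : 'I_n -> nat, [/\ forall x, (D0 <= d x)%N,
    forall i, (i <= s)%N -> #|cell d (D0 + i)%N| = m i &
    \sum_x 2 ^- d x = 1 :> R].
Proof.
move=> t0 sn mass.
pose l := flatten [seq nseq (m i) (D0 + i)%N | i <- iota 0 s.+1] ++ chain (D0 + s) t.
have sl : size l = n.
  rewrite size_cat size_chain size_flatten /shape -map_comp sumnE big_map.
  rewrite -sn; congr (_ + _)%N; rewrite -(subn0 s.+1) -/(index_iota 0 s.+1) big_mkord.
  by apply: eq_bigr => i _ /=; rewrite size_nseq.
have [d [dc dF]] := seq_exponents sl.
exists d; split.
- move=> x; have : (0 < count_mem (d x) l)%N.
    by rewrite -dc; apply/card_gt0P; exists x; rewrite inE.
  rewrite -has_count => /hasP[e + /eqP <-]; rewrite mem_cat => /orP[|].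
    by case/flattenP => _ /mapP[i _ ->]; rewrite mem_nseq => /andP[_ /eqP ->]; rewrite leq_addr.
  by move/(chain_gt t0) => /ltnW; apply: leq_trans; rewrite leq_addr.
- move=> i is_; rewrite dc /l count_cat [X in (_ + X)%N](_ : _ = 0%N); last first.
    apply/eqP; rewrite -leqn0 leqNgt -has_count; apply/hasP => -[e /(chain_gt t0) + /eqP E].
    by rewrite E ltn_add2l ltnNge is_.
  rewrite addn0 count_flatten -map_comp sumnE big_map.
  rewrite -(subn0 s.+1) -/(index_iota 0 s.+1) big_mkord.
  have is1 : (i < s.+1)%N by [].
  rewrite (bigD1 (Ordinal is1)) //= count_nseq /= eqxx mul1n big1 ?addn0 //.
  by move=> j ji; rewrite /= count_nseq /= eqn_add2l (negPf (_ : j != i :> nat)%N) // mul0n.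
- rewrite (dF (fun e => 2 ^- e)) /l; set l1 := flatten _.
  rewrite big_cat /= sum_chain -[RHS]mass; congr (_ + _); rewrite /l1 big_flatten big_map.
  rewrite -(subn0 s.+1) -/(index_iota 0 s.+1) big_mkord.
  by apply: eq_bigr => i _; rewrite big_nseq iter_addr_0 mulr_natl.
Qed.

End Design.

(** * Counting the splits of such a distribution *)

Section UpperCount.
Variables (R : realType) (n D0 s : nat) (d : 'I_n -> nat).

Let D := (D0 + s)%N.
Let N := D.+1.
Let mu (x : 'I_n) : R := 2 ^- d x.

Hypothesis D0_gt0 : (0 < D0)%N.
Hypothesis dD0 : forall x, (D0 <= d x)%N.
Hypothesis mu1 : \sum_x mu x = 1.
Hypothesis mu_deep : \sum_(x | (D < d x)%N) mu x = 2 ^- D.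

Let mu_gt0 x : 0 < mu x. Proof. by rewrite invr_gt0 exprn_gt0. Qed.

(* Modulo [2 ^- D] the deep elements weigh nothing, so a split takes all or none
   of them. *)
Lemma split_deep (A : {set 'I_n}) : \sum_(x in A) mu x = 2^-1 ->
  (forall x, x \in A -> (d x < N)%N) \/ (forall x, x \notin A -> (d x < N)%N).
Proof.
move=> A12.
pose q := (\sum_(x in A | (d x < N)%N) 2 ^ (D - d x))%N.
have p0 : 0 < (2 : R) ^+ D by rewrite exprn_gt0.
have qE : \sum_(x in A | (d x < N)%N) mu x = q%:R * 2 ^- D.
  rewrite natr_sum mulr_suml; apply: eq_bigr => x /andP[_ dx].
  rewrite natrX expfB_cond ?pnatr_eq0 //.
  by rewrite mulrAC divff ?mul1r // gt_eqF.
set u := \sum_(x in A | (d x < N)%N) mu x in qE.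
pose g := \sum_(x in A | ~~ (d x < N)%N) mu x.
pose g' := \sum_(x in (~: A)%SET | ~~ (d x < N)%N) mu x.
have ug : u + g = 2^-1 by rewrite -A12 (bigID (fun x => (d x < N)%N)).
have gg : g + g' = 2 ^- D.
  rewrite -mu_deep [RHS](bigID (mem A)) /=; congr (_ + _).
    by apply: eq_bigl => x; rewrite ltnS -ltnNge andbC.
  by apply: eq_bigl => x; rewrite inE ltnS -ltnNge andbC.
have g0 : 0 <= g by apply: sumr_ge0 => x _; exact: ltW.
have g0' : 0 <= g' by apply: sumr_ge0 => x _; exact: ltW.
have D_gt0 : (0 < D)%N by rewrite addn_gt0 D0_gt0.
have half : (2 ^ D.-1)%:R * 2 ^- D = 2^-1 :> R.
  by rewrite natrX -{2}(prednK D_gt0) exprS invfM mulrCA divff ?mulr1 // gt_eqF ?exprn_gt0.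
have q1 : (q <= 2 ^ D.-1)%N.
  by rewrite -(ler_nat R) -(@ler_pM2r _ (2 ^- D)) ?invr_gt0 // half -qE; lra.
have q2 : (2 ^ D.-1 <= q.+1)%N.
  rewrite -(ler_nat R) -(@ler_pM2r _ (2 ^- D)) ?invr_gt0 // half.
  by rewrite -[q.+1%:R]natr1 mulrDl mul1r -qE; lra.
(* The value 1/2 and the shallow part of [A] are multiples of [2 ^- D], and the deep part lies
   between 0 and [2 ^- D]; hence it is one of these two values. *)
have [E|E] : q = (2 ^ D.-1)%N \/ q.+1 = (2 ^ D.-1)%N by lia.
- left => x xA; rewrite ltnNge; apply/negP => dx.
  have gz : g = 0 by move: ug; rewrite qE E half; lra.
  move: gz; rewrite /g (bigD1 x) /=; last by rewrite xA -leqNgt.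
  have : 0 <= \sum_(i | (i \in A) && ~~ (d i < N)%N && (i != x)) mu i.
    by apply: sumr_ge0 => y _; exact: ltW.
  by move: (mu_gt0 x); lra.
- right => x xA; rewrite ltnNge; apply/negP => dx.
  have gz : g' = 0.
    by move: ug; rewrite qE -half -E -[q.+1%:R]natr1 mulrDl mul1r; lra.
  move: gz; rewrite /g' (bigD1 x) /=; last by rewrite inE xA -leqNgt.
  have : 0 <= \sum_(i | (i \in (~: A)%SET) && ~~ (d i < N)%N && (i != x)) mu i.
    by apply: sumr_ge0 => y _; exact: ltW.
  by move: (mu_gt0 x); lra.
Qed.

Let Out (j : nat) : {set {set 'I_n}} :=
  [set A in Spl mu j | A \subset [set x | (d x < N)%N]]%SET.

(** A split that contains the deep atoms is replaced by its complement, a split of size [n - j] that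
    avoids them. *)
Lemma card_Spl_le j : (#|Spl mu j| <= #|Out j| + #|Out (n - j)|)%N.
Proof.
apply: leq_trans (_ : #|(Out j :|: [set ~: A | A in Out (n - j)])%SET| <= _)%N.
  apply: subset_leq_card; apply/fintype.subsetP => A AS.
  have := AS; rewrite inE => /andP[/eqP cA /eqP mA].
  rewrite inE; case: (split_deep mA) => H.
    rewrite [A \in Out j]inE AS (_ : A \subset _) //.
    by apply/fintype.subsetP => x xA; rewrite inE H.
  apply/orP; right; apply/imsetP; exists (~: A)%SET; last by rewrite finset.setCK.
  rewrite inE; apply/andP; split.
    rewrite inE cardsCs finset.setCK card_ord cA eqxx /=.
    have : \sum_(x in A) mu x + \sum_(x in (~: A)%SET) mu x = 1.
      rewrite -mu1 [RHS](bigID (mem A)) /=; congr (_ + _).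
      by apply: eq_bigl => x; rewrite inE.
    by rewrite mA => E; apply/eqP; lra.
  by apply/fintype.subsetP => x; rewrite !inE => /H.
apply: leq_trans (leq_card_setU _ _) _; rewrite leq_add2l.
exact: leq_imset_card.
Qed.

Variable B : R.
Hypothesis B0 : 0 <= B.
Hypothesis HB : forall a : nat -> nat,
  (forall j, (j < N)%N -> (a j <= #|cell d j|)%N) ->
  \sum_(j < N) (a j)%:R * 2 ^- j = 2^-1 :> R ->
  (\prod_(j < N) 'C(#|cell d j|, a j))%:R <= B * 'C(n, \sum_(j < N) a j)%:R.

(** Sets are sorted by their counts at the [s + 1] depths from [D0] to [D0 + s], so there are at
    most [(n + 1) ^ (s + 1)] classes; [HB] bounds each nonempty class through the counts of one of
    its members. *)
Lemma card_Out_le j : (#|Out j|)%:R <= (n.+1 ^ s.+1)%:R * (B * 'C(n, j)%:R).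
Proof.
pose cnt (A : {set 'I_n}) : {ffun 'I_s.+1 -> 'I_n.+1} :=
  [ffun i : 'I_s.+1 => inord #|(A :&: cell d (D0 + i)%N)%SET|].
have -> : (n.+1 ^ s.+1)%:R * (B * 'C(n, j)%:R) =
    \sum_(v : {ffun 'I_s.+1 -> 'I_n.+1}) B * 'C(n, j)%:R.
  by rewrite sumr_const card_ffun !card_ord mulr_natl.
rewrite -sum1_card natr_sum (partition_big cnt xpredT) //=.
apply: ler_sum => v _.
rewrite -natr_sum sum1dep_card.
have [/eqP ->|] := boolP (#|[set A in Out j | cnt A == v]%SET| == 0%N).
  by rewrite mulr_ge0 ?ler0n.
rewrite cards_eq0 => /finset.set0Pn[A0]; rewrite !inE.
move=> /andP[/andP[/andP[/eqP cA0 /eqP mA0] A0N] /eqP vA0].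
have dA0 x : x \in A0 -> (d x < N)%N.
  by move/(fintype.subsetP A0N); rewrite inE.
pose a i := #|(A0 :&: cell d i)%SET|.
have aN i : (i < N)%N -> (a i <= #|cell d i|)%N.
  by move=> _; apply: subset_leq_card; exact: finset.subsetIr.
have am : \sum_(i < N) (a i)%:R * 2 ^- i = 2^-1 :> R.
  by rewrite -mA0 (sum_cells (fun i => 2 ^- i) dA0).
have Ej : j = (\sum_(i < N) a i)%N by rewrite -cA0 (card_cells R dA0).
have := HB aN am; rewrite -Ej; apply: le_trans; rewrite ler_nat.
rewrite -card_with_counts; apply: subset_leq_card.
apply/fintype.subsetP => A; rewrite !inE => /andP[/andP[_ AN] /eqP vA].
rewrite AN /=; apply/forallP => i.
have [iD|Di] := ltnP i D0.
  have cN : cell d i = finset.set0.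
    apply/setP => x; rewrite !inE; apply/negbTE; apply/eqP => dx.
    by have := dD0 x; rewrite dx leqNgt iD.
  by rewrite /a cN !finset.setI0.
have iS : (i - D0 < s.+1)%N by have := ltn_ord i; rewrite /N /D; lia.
have := vA; rewrite -vA0 => /ffunP /(_ (Ordinal iS)).
rewrite !ffunE /= subnKC // => /(congr1 val) /=.
have bd (X : {set 'I_n}) : (#|X| < n.+1)%N.
  by rewrite ltnS -[X in (_ <= X)%N]card_ord max_card.
by rewrite !inordK // => ->.
Qed.

Lemma rho_le : rho_Spl mu <= 2 * ((n.+1 ^ s.+1)%:R * B).
Proof.
rewrite /rho_Spl big_seq_cond; apply: bigmax_le => [|j].
  by rewrite !mulr_ge0 ?ler0n.
rewrite andbT mem_index_iota => /andP[j1 jn].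
have C0 : 0 < 'C(n, j)%:R :> R by rewrite ltr0n bin_gt0 ltnW.
rewrite ler_pdivrMr //.
apply: le_trans (_ : (#|Out j| + #|Out (n - j)|)%:R <= _).
  by rewrite ler_nat card_Spl_le.
have H1 := card_Out_le j; have := card_Out_le (n - j)%N.
rewrite bin_sub ?(ltnW jn) // natrD; lra.
Qed.

End UpperCount.

(** * Elementary bounds and admissible distributions for [rho_min] *)

Section RhoMin.
Variable R : realType.

Lemma rho_ge0 n (mu : 'I_n -> R) : 0 <= rho_Spl mu.
Proof. exact: bigmax_ge_id. Qed.

Lemma rho_le1 n (mu : 'I_n -> R) : rho_Spl mu <= 1.
Proof.
rewrite /rho_Spl big_seq_cond; apply: bigmax_le => [|j]; first exact: ler01.
rewrite andbT mem_index_iota => /andP[j1 jn].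
rewrite ler_pdivrMr ?ltr0n ?bin_gt0 ?(ltnW jn) // mul1r ler_nat.
rewrite -[n in 'C(n, _)]card_ord -card_draws; apply: subset_leq_card.
by apply/fintype.subsetP => A; rewrite !inE => /andP[].
Qed.

Lemma rho_min_le n (d : 'I_n -> nat) : (forall x, (0 < d x)%N) ->
  \sum_x 2 ^- d x = 1 :> R ->
  rho_min R n <= rho_Spl (fun x => 2 ^- d x : R).
Proof.
move=> d0 d1; apply: ge_inf.
  by exists 0 => _ [mu _ <-]; exact: rho_ge0.
exists (fun x => 2 ^- d x) => //; split.
- by split=> // x; rewrite invr_ge0 exprn_ge0.
- by move=> x; right; exists (d x).
- move=> [x /eqP]; rewrite invr_eq1 => /eqP E.
  have : 1 < (2 : R) ^+ d x by rewrite exprn_egt1 ?ltr1n // -lt0n.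
  by rewrite E ltxx.
- by move=> x; rewrite invr_eq0 expf_neq0 // pnatr_eq0.
Qed.

Lemma chain_exponents n : (1 < n)%N -> exists d : 'I_n -> nat,
  (forall x, (0 < d x)%N) /\ \sum_x 2 ^- d x = 1 :> R.
Proof.
move=> n1; have n0 : (0 < n.-1)%N by lia.
have sl : size (chain 0 n.-1) = n by rewrite size_chain prednK // ltnW.
have [d [dc dF]] := seq_exponents R sl; exists d; split.
  move=> x; have : (0 < count_mem (d x) (chain 0 n.-1))%N.
    by rewrite -dc; apply/card_gt0P; exists x; rewrite inE.
  by rewrite -has_count => /hasP[e /(chain_gt n0) + /eqP <-].
by rewrite (dF (fun e => 2 ^- e)) sum_chain expr0 invr1.
Qed.

End RhoMin.

(** * Quantitative upper bound from a nearly optimal [c] *)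

Section UpperBound.
Variables (R : realType) (beta : R).
Hypothesis hbeta : 1 <= beta.
Variables (c : nat -> R) (b : nat).
Hypothesis C : calC beta (c, b).
Variable M : R.
Hypothesis PM : forall alpha, calA beta c b alpha -> P c alpha <= M.

Let T : R := (beta * 2 ^+ b.+1)^-1.
Let beta0 : 0 < beta. Proof. exact: lt_le_trans hbeta. Qed.
Let c01 i : 0 <= c i <= 1. Proof. by case: C. Qed.
Let C1 : R := limn (series c).

Variables (s k n : nat) (delta : R).
Hypothesis hn : n%:R = beta * 2 ^+ k.
Hypothesis bk : (b < k)%N.
Hypothesis small : C1 - \sum_(i < s) c i + (2 * s * 2 ^ s)%:R / n%:R <= delta.
Hypothesis room : (2 * s * 2 ^ s).+1%:R <= n%:R * (1 - C1).

(** The shift between indices of [c] and depths: about [n * c i] atoms at depth [D0 + i] have total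
    mass about [n / (beta * 2 ^ b * 2 ^ D0) = 1]. *)
Let D0 := (k - b)%N.
Let D := (D0 + s)%N.
Let tail : R := C1 - \sum_(i < s) c i.
Let p0 j : 0 < (2 : R) ^+ j. Proof. by rewrite exprn_gt0. Qed.
Let n0 : 0 < n%:R :> R. Proof. by rewrite hn mulr_gt0. Qed.
Let n_gt0 : (0 < n)%N. Proof. by move: n0; rewrite ltr0n. Qed.
Let D0_gt0 : (0 < D0)%N. Proof. by rewrite subn_gt0. Qed.

Let nD0 : n%:R * (beta * 2 ^+ b)^-1 = 2 ^+ D0.
Proof.
have -> : n%:R = beta * (2 ^+ D0 * 2 ^+ b) by rewrite -exprD subnK // ltnW.
by field; rewrite !gt_eqF.
Qed.

(** The extra decrement gives [m0 i <= (n - 1) * c i], which leaves a strictly positive mass for the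
    block. *)
Let m0 i := (Num.truncn (n%:R * c i)).-1.

Let m0_le i : (m0 i)%:R <= (n%:R - 1) * c i.
Proof.
have /andP[ci0 ci1] := c01 i; have n1 : 1 <= n%:R :> R by rewrite ler1n.
rewrite /m0; case E : (Num.truncn _) => [|t] /=.
  by rewrite mulr_ge0 ?subr_ge0.
have nc0 : 0 <= n%:R * c i by rewrite mulr_ge0 ?ler0n.
have /andP[H _] := truncn_itv nc0; move: H.
rewrite E -natr1 mulrBl mul1r; lra.
Qed.

Let m0_ge i : n%:R * c i <= (m0 i)%:R + 2.
Proof.
have /andP[ci0 ci1] := c01 i.
have nc0 : 0 <= n%:R * c i by rewrite mulr_ge0 ?ler0n.
have /andP[_ /ltW H] := truncn_itv nc0; apply: (le_trans H).
rewrite -(natrD R _ 2) ler_nat /m0; lia.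
Qed.

Let S0 : R := \sum_(i < s) (m0 i)%:R * 2 ^- i.

Let sum_c_tail : 2 ^+ D0 <= S0 + 2 * s%:R + n%:R * (2 ^- s * tail).
Proof.
rewrite -nD0; apply: le_trans (_ : n%:R * (\sum_(i < s) c i / 2 ^+ i + 2 ^- s * tail) <= _).
  by rewrite ler_pM2l //; exact: geom_tail_le.
rewrite mulrDr lerD2r mulr_sumr.
have -> : 2 * s%:R = \sum_(i < s) 2 :> R by rewrite sumr_const card_ord mulr_natr.
rewrite -big_split /=; apply: ler_sum => i _; rewrite mulrA.
apply: le_trans (_ : ((m0 i)%:R + 2) * 2 ^- i <= _).
  by rewrite ler_pM2r ?invr_gt0.
rewrite mulrDl lerD2l ler_piMr // invf_le1 // exprn_ege1 // ler1n.
by [].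
Qed.

Let S0_lt : S0 < 2 ^+ D0.
Proof.
have n1 : 1 <= n%:R :> R by rewrite ler1n.
have cg0 i : 0 <= c i / 2 ^+ i.
  by rewrite divr_ge0 ?(ltW (p0 _)) //; case/andP: (c01 i).
apply: le_lt_trans (_ : (n%:R - 1) * (beta * 2 ^+ b)^-1 < _); last first.
  by rewrite mulrBl nD0 mul1r gtrBl invr_gt0 mulr_gt0.
have [_ <- _ _] := C.
apply: le_trans (_ : (n%:R - 1) * \sum_(i < s) c i / 2 ^+ i <= _); last first.
  rewrite ler_wpM2l ?subr_ge0 //.
  exact: partial_sum_le_lim cg0 (calC_geom_cvg C).
rewrite mulr_sumr; apply: ler_sum => i _; rewrite mulrA.
by rewrite ler_pM2r ?invr_gt0.
Qed.

Let U := (\sum_(i < s) m0 i * 2 ^ (s - i))%N.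

Let UE : U%:R = S0 * 2 ^+ s.
Proof.
rewrite natr_sum mulr_suml; apply: eq_bigr => i _.
rewrite natrM natrX -mulrA; congr (_ * _).
by rewrite expfB_cond ?pnatr_eq0 ?(ltnW (ltn_ord i)) // mulrC.
Qed.

Let UD : (U < 2 ^ D)%N.
Proof. by rewrite -(ltr_nat R) UE natrX exprD ltr_pM2r. Qed.

Let q := (2 ^ D - U)%N.

Let q_gt0 : (0 < q)%N. Proof. by rewrite subn_gt0. Qed.

Let qE : q%:R = (2 ^+ D0 - S0) * 2 ^+ s.
Proof. by rewrite natrB ?(ltnW UD) // UE natrX exprD mulrBl. Qed.

(** Rounding costs at most two atoms at each of the [s] depths, and one atom is worth at most
    [2 ^ s] units of [2 ^- D]; the rest is the tail of [c]. *)
Let q_le : q%:R <= (2 * s * 2 ^ s)%:R + n%:R * tail.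
Proof.
rewrite qE [X in _ <= X + _](_ : _ = 2 * s%:R * 2 ^+ s); last first.
  by rewrite !natrM natrX.
have -> : n%:R * tail = n%:R * (2 ^- s * tail) * 2 ^+ s.
  by field; rewrite gt_eqF.
by rewrite -mulrDl ler_pM2r //; move: sum_c_tail; lra.
Qed.

(** The missing mass is [q] units of [2 ^- D]: [q - 1] of them become atoms at depth [D], and the
    last one is left to the chain. *)
Let m i := if (i < s)%N then m0 i else q.-1.

Let sum_m (F : nat -> nat -> R) :
  \sum_(i < s.+1) F i (m i) = \sum_(i < s) F i (m0 i) + F s q.-1.
Proof.
rewrite big_ord_recr /= /m ltnn; congr (_ + _).
by apply: eq_bigr => i _; rewrite ltn_ord.
Qed.

Let total : (\sum_(i < s.+1) m i + 2 <= n)%N.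
Proof.
rewrite -(ler_nat R) natrD natr_sum (sum_m (fun _ x => x%:R)).
have q1 : q.-1%:R = q%:R - 1 :> R by rewrite -[q in RHS]prednK // -natr1 addrK.
have : \sum_(i < s) (m0 i)%:R <= n%:R * \sum_(i < s) c i.
  rewrite mulr_sumr; apply: ler_sum => i _; apply: (le_trans (m0_le i)).
  by rewrite mulrBl mul1r gerBl; case/andP: (c01 i).
rewrite q1; move: q_le room; rewrite -[_.+1%:R]natr1 /tail; lra.
Qed.

Let t := (n - \sum_(i < s.+1) m i).-1.

Let deltaT0 : 0 < T. Proof. by rewrite invr_gt0 mulr_gt0. Qed.

Let M' := M + delta + 12 * Num.sqrt (delta / T) + 12 * Num.sqrt (delta / T + delta).

(** The factor 2 comes from complementation, [n.+1 ^ s.+1] from the number of count vectors, and the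
    single [n.+1] from the entropy bound for ['C(n, Sa)]. *)
Lemma rho_min_upper_quant : rho_min R n <=
  2 * ((n.+1 ^ s.+1)%:R * (n.+1%:R * 2 `^ (n%:R * M'))).
Proof.
have t0 : (0 < t)%N by rewrite /t; move: total; lia.
have tn : (\sum_(i < s.+1) m i + t.+1)%N = n by rewrite /t; move: total; lia.
have mass : \sum_(i < s.+1) (m i)%:R * 2 ^- (D0 + i) + 2 ^- D = 1 :> R.
  rewrite (sum_m (fun i x => x%:R * 2 ^- (D0 + i))) -addrA -[X in _ + X]mulr1.
  rewrite -/D mulr1 -{2}[2 ^- D]mul1r -mulrDl natr1 prednK // qE.
  have -> : \sum_(i < s) (m0 i)%:R * 2 ^- (D0 + i) = S0 * 2 ^- D0.
    by rewrite mulr_suml; apply: eq_bigr => i _; rewrite exprD invfM; ring.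
  by rewrite /D exprD; field; rewrite !gt_eqF.
have [d [dD0 dm d1]] := design t0 tn mass.
have d0 x : (0 < d x)%N by apply: leq_trans (dD0 x).
have empty j : (j < D0)%N -> #|cell d j| = 0%N.
  move=> jD; apply/eqP; rewrite cards_eq0; apply/eqP/setP => x; rewrite !inE.
  by apply/negbTE/eqP => E; move: (dD0 x); rewrite E leqNgt jD.
have sumN (F : nat -> R) : (forall j, (j < D0)%N -> F j = 0) ->
    \sum_(j < D.+1) F j = \sum_(i < s.+1) F (D0 + i)%N.
  move=> F0; rewrite /D -addnS sum_split2 big1 ?add0r // => i _.
  exact: F0.
have deep : \sum_(x | (D < d x)%N) 2 ^- d x = 2 ^- D :> R.
  have /esym : \sum_x 2 ^- d x = 1 :> R by [].
  rewrite (bigID (fun x => (d x < D.+1)%N)) /=.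
  have -> : \sum_(x | (d x < D.+1)%N) 2 ^- d x = 1 - 2 ^- D :> R.
    transitivity (\sum_(x in [set x | (d x < D.+1)%N]%SET) 2 ^- d x : R).
      by apply: eq_bigl => x; rewrite inE.
    rewrite (sum_cells (fun j => 2 ^- j) (N := D.+1)); last by move=> x; rewrite inE.
    rewrite -[X in _ = X - _]mass addrK.
    transitivity (\sum_(i < s.+1) (#|cell d (D0 + i)%N|)%:R * 2 ^- (D0 + i) : R);
      last by apply: eq_bigr => i _; rewrite dm // -ltnS.
    rewrite -(sumN (fun j => (#|cell d j|)%:R * 2 ^- j)).
      apply: eq_bigr => j _; congr (_%:R * _); apply: eq_card => x.
      by rewrite !inE; case: eqP => [->|]; rewrite ?ltn_ord ?andbF.
    by move=> j /empty ->; rewrite mul0r.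
  move=> E; transitivity (\sum_(i | ~~ (d i < D.+1)%N) 2 ^- d i : R); last lra.
  by apply: eq_bigl => x; rewrite -leqNgt.
have cellE i : (i < s.+1)%N -> #|cell d (D0 + i)%N| = m i.
  by move=> si; apply: dm.
apply: le_trans (rho_min_le d0 d1) _.
apply: (rho_le D0_gt0 dD0 d1 deep); first by rewrite mulr_ge0 ?ler0n ?powR_ge0.
move=> a aN a12.
have P0 : (0 < \prod_(j < D.+1) 'C(#|cell d j|, a j))%N.
  by rewrite prodn_gt0 // => j; rewrite bin_gt0 aN.
have a0 j : (j < D0)%N -> a j = 0%N.
  move=> jD; apply/eqP; rewrite -leqn0 -(empty j jD) aN // /D.
  by apply: leq_trans jD _; rewrite leqW // leq_addr.
have am i : (i < s.+1)%N -> (a (D0 + i) <= m i)%N.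
  by move=> si; rewrite -(cellE _ si) aN // /D ltnS leq_add2l.
set Sa := (\sum_(j < D.+1) a j)%N.
have SaE : Sa%:R = \sum_(i < s.+1) (a (D0 + i)%N)%:R :> R.
  rewrite natr_sum; apply: (sumN (fun j => (a j)%:R)) => j jD.
  by rewrite a0.
have San : (Sa <= n)%N.
  rewrite -tn -(ler_nat R) SaE natrD natr_sum.
  have : \sum_(i < s.+1) (a (D0 + i))%:R <= \sum_(i < s.+1) (m i)%:R :> R.
    by apply: ler_sum => i _; rewrite ler_nat am.
  have : 0 <= t.+1%:R :> R by rewrite ler0n.
  lra.
have C0 : 0 < 'C(n, Sa)%:R :> R by rewrite ltr0n bin_gt0.
have lP : log2 (\prod_(j < D.+1) 'C(#|cell d j|, a j))%:R <=
    \sum_(i < s.+1) phi (m i)%:R (a (D0 + i)%N)%:R :> R.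
  rewrite log2_nat_prod; last by move=> j _; rewrite bin_gt0 aN.
  rewrite (sumN (fun j => log2 'C(#|cell d j|, a j)%:R)).
    apply: ler_sum => i _; rewrite cellE //.
    by have /andP[] := log2_bin R (am i (ltn_ord i)).
  by move=> j jD; rewrite a0 // bin0 log2_1.
pose y i := (a (D0 + i)%N)%:R / n%:R : R.
pose w i := (m i)%:R / n%:R : R.
have yw i : (i < s.+1)%N -> 0 <= y i <= w i.
  by move=> si; rewrite divr_ge0 ?ler0n //= ler_pM2r ?invr_gt0 // ler_nat am.
have phiE : \sum_(i < s.+1) phi (m i)%:R (a (D0 + i)%N)%:R =
    n%:R * (\sum_(i < s) phi (w i) (y i) + phi (w s) (y s)).
  transitivity (n%:R * \sum_(i < s.+1) phi (w i) (y i)); last first.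
    by rewrite big_ord_recr.
  rewrite mulr_sumr.
  apply: eq_bigr => i _; rewrite -phiM ?ler0n ?yw // /w /y.
  by congr phi; field; rewrite gt_eqF.
have wc i : (i < s)%N -> w i <= c i.
  move=> si; rewrite /w /m si ler_pdivrMr // mulrC; apply: (le_trans (m0_le i)).
  by rewrite mulrBl mul1r gerBl; case/andP: (c01 i).
have q1 : q.-1%:R <= q%:R :> R by rewrite ler_nat leq_pred.
have wsd : w s <= delta.
  apply: le_trans small; rewrite /w /m ltnn ler_pdivrMr // mulrDl divfK ?gt_eqF //.
  by move: q_le q1; rewrite /tail; lra.
have SaY : Sa%:R / n%:R = \sum_(i < s) y i + y s.
  by rewrite SaE mulr_suml big_ord_recr.
have yT : \sum_(i < s) y i / 2 ^+ i + y s / 2 ^+ s = T.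
  have := a12; rewrite (sumN (fun j => (a j)%:R * 2 ^- j)); last first.
    by move=> j jD; rewrite a0 // mul0r.
  (* Rescaling turns depths [D0 + i] into indices [i] and counts into fractions of [n]; mass 1/2
     becomes [T]. *)
  move=> /(congr1 (fun x => x * (2 ^+ D0 / n%:R))).
  rewrite -{2}nD0 [n%:R * _]mulrC mulfK ?gt_eqF // => E.
  transitivity (2^-1 * (beta * 2 ^+ b)^-1); last first.
    by rewrite /T exprS; field; rewrite !gt_eqF.
  rewrite -E mulr_suml big_ord_recr /=; congr (_ + _).
    by apply: eq_bigr => i _; rewrite /y exprD; field; rewrite !gt_eqF.
  by rewrite /y exprD; field; rewrite !gt_eqF.
have Sa01 : 0 <= (Sa%:R / n%:R : R) <= 1.
  by rewrite divr_ge0 ?ler0n //= ler_pdivrMr // mul1r ler_nat.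
have ysum1 : \sum_(i < s) y i + y s <= 1 by rewrite -SaY; case/andP: Sa01.
have key := upper_key hbeta C PM (fun i si => yw i (ltnW si)) wc (yw s (ltnSn s)) yT ysum1.
rewrite -SaY in key.
have ws0 : 0 <= w s by rewrite divr_ge0 ?ler0n.
have Ti0 : 0 < T^-1 by rewrite invr_gt0; exact: deltaT0.
have r1 : Num.sqrt (w s / T) <= Num.sqrt (delta / T).
  by apply: ler_wsqrtr; rewrite (ler_pM2r Ti0).
have r2 : Num.sqrt (w s / T + w s) <= Num.sqrt (delta / T + delta).
  by apply: ler_wsqrtr; rewrite lerD // (ler_pM2r Ti0).
have keyM : \sum_(i < s) phi (w i) (y i) + phi (w s) (y s) <= M' + h (Sa%:R / n%:R).
  by rewrite /M'; move: key wsd r1 r2; rewrite -/T; lra.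
have /andP[lC _] := log2_bin R San.
have hE : phi n%:R Sa%:R = n%:R * h (Sa%:R / n%:R) :> R.
  by rewrite -phi_h ?ler0n //; congr phi; field; rewrite gt_eqF.
have lb : log2 (\prod_(j < D.+1) 'C(#|cell d j|, a j))%:R <=
    log2 n.+1%:R + n%:R * M' + log2 'C(n, Sa)%:R :> R.
  have : n%:R * (\sum_(i < s) phi (w i) (y i) + phi (w s) (y s)) <=
    n%:R * (M' + h (Sa%:R / n%:R)) by rewrite ler_pM2l.
  by move: lP lC; rewrite phiE hE; lra.
rewrite -[leLHS]powR2_log2 ?ltr0n //.
rewrite -[n.+1%:R in leRHS]powR2_log2 ?ltr0n // -[X in _ <= _ * X]powR2_log2 //.
rewrite -!powRD ?pnatr_eq0 ?implybT //.
by rewrite ler_powR // ler1n.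
Qed.

End UpperBound.

(** * Choice of parameters and the limit *)

Section Asymptotics.
Variables (R : realType) (beta : R).

Lemma exp2_ge (x : R) : exists s : nat, x <= 2 ^+ s.
Proof.
exists (Num.truncn `|x|).+1; have /andP[_ /ltW H] := truncn_itv (normr_ge0 x).
apply: le_trans (ler_norm x) (le_trans H _).
by rewrite -natrX ler_nat ltnW // ltn_expl.
Qed.

Lemma sqrt_exp2_small (K e : R) : 0 < K -> 0 < e ->
  exists s0 : nat, forall s, (s0 <= s)%N -> K * Num.sqrt (2 ^- s) <= e.
Proof.
move=> K0 e0; have [s0 Hs0] := exp2_ge ((K / e) ^+ 2).
exists s0 => s s0s.
have Ke0 : 0 < K / e by rewrite divr_gt0.
have : Num.sqrt (2 ^- s) <= (K / e)^-1 * Num.sqrt 1.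
  apply: sqrt_le_scale; [by rewrite invr_ge0 ltW | exact: ler01 |].
  rewrite mulr1 exprVn lef_pV2 ?posrE ?exprn_gt0 //; apply: (le_trans Hs0).
  by rewrite ler_weXn2l // ler1n.
rewrite sqrtr1 mulr1 invf_div ler_pdivlMr // mulrC.
exact.
Qed.

Lemma rho_min_lower (eps : R) : 1 <= beta < 2 -> 0 < eps ->
  exists X : R, forall k n : nat, n%:R = beta * 2 ^+ k -> X <= n%:R ->
  2 `^ ((G beta - eps) * n%:R) <= rho_min R n.
Proof.
move=> hbeta e0; have e2 : 0 < eps / 2 by rewrite divr_gt0.
have K0 : 0 < 163 :> R by rewrite ltr0n.
have [s0 Hs0] := sqrt_exp2_small K0 e2.
pose s := (s0 + 3)%N.
have s3 : (3 <= s)%N by rewrite leq_addl.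
pose W := (s ^ 2 * (2 ^ (2 * s) * (2 * s).+1))%N.
(* The first summand forces [s < k], the second provides [sE]. *)
exists (2 ^+ s.+1 + 2 ^+ s * W%:R) => k n hn nX.
have p0 j : 0 < (2 : R) ^+ j by rewrite exprn_gt0.
have W0 : 0 <= 2 ^+ s * W%:R :> R by rewrite mulr_ge0 ?ler0n ?ltW.
have n_lt : n%:R < 2 ^+ k.+1 :> R.
  by rewrite hn exprS ltr_pM2r //; case/andP: hbeta.
have sk : (s < k)%N.
  have : 2 ^+ s.+1 < 2 ^+ k.+1 :> R by apply: le_lt_trans n_lt; lra.
  by rewrite ltr_eXn2l ?ltr1n.
have WK : W%:R <= 2 ^- s * n%:R :> R.
  by rewrite mulrC ler_pdivlMr // mulrC; have := p0 s.+1; lra.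
have n1 : (1 < n)%N.
  rewrite -(ltr_nat R); apply: lt_le_trans nX.
  have : 2 ^+ 1 <= 2 ^+ s.+1 :> R by rewrite ler_weXn2l // ler1n.
  have : 1 < 2 ^+ 1 :> R by rewrite expr1 ltr1n.
  lra.
have sig : 163 * Num.sqrt (2 ^- s) <= eps / 2 :> R by apply: Hs0; rewrite leq_addr.
have [d [d0 d1]] := chain_exponents R n1.
apply: lb_le_inf.
  eexists; exists (fun x => 2 ^- d x); last by [].
  split; last by move=> x; rewrite invr_eq0 expf_neq0 // pnatr_eq0.
  - by split=> // x; rewrite invr_ge0 ltW.
  - by move=> x; right; exists (d x).
  - move=> [x /eqP]; rewrite invr_eq1 => /eqP E.
    have : 1 < (2 : R) ^+ d x by rewrite exprn_egt1 ?ltr1n // -lt0n.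
    by rewrite E ltxx.
move=> _ [mu [mud mudy munc mufs] <-].
have [e ePr] := dyadic_exponent mudy mufs munc.
have [r0 rl] := rho_lower hbeta hn (fun x => (ePr x).2) (fun x => (ePr x).1)
  mud s3 sk WK e2.
rewrite -[leRHS]powR2_log2 //; apply: ler_powR; first by rewrite ler1n.
apply: le_trans rl; rewrite mulrC ler_wpM2l ?ler0n //; lra.
Qed.

Lemma rho_min_upper (eps : R) : 1 <= beta < 2 -> 0 < eps ->
  exists X : R, forall k n : nat, n%:R = beta * 2 ^+ k -> X <= n%:R ->
  rho_min R n <= 2 `^ ((G beta + eps) * n%:R).
Proof.
move=> /andP[hbeta beta2] e0; have [Ge|Ge] := leP 0 (G beta + eps).
  exists 2 => k n hn n2.
  have n1 : (1 < n)%N by rewrite -(ler_nat R).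
  have [d [d0 d1]] := chain_exponents R n1.
  apply: (le_trans (rho_min_le d0 d1)); apply: (le_trans (rho_le1 _)).
  rewrite -[leLHS](powRr0 (2 : R)); apply: ler_powR; first by rewrite ler1n.
  by rewrite mulr_ge0 ?ler0n.
have e4 : 0 < eps / 4 by rewrite divr_gt0.
have [[c b] C PM] := G_approx hbeta e4; rewrite /= in PM.
have p0 j : 0 < (2 : R) ^+ j by rewrite exprn_gt0.
have b0 : 0 < beta by exact: lt_le_trans hbeta.
(* Total weight 1 would give [P = 0] at [alpha = 1/2], hence [0 <= G beta + eps / 4], against
   [G beta + eps < 0]. *)
have C1 : limn (series c) < 1.
  have [_ _ _ c1] := C; rewrite lt_neqAle c1 andbT; apply/eqP => cE.
  by have := PM _ (calA_half C); rewrite (P_half C cE); lra.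
pose T : R := (beta * 2 ^+ b.+1)^-1.
have T0 : 0 < T by rewrite invr_gt0 mulr_gt0.
have T1 : T <= 1.
  rewrite invf_le1 ?mulr_gt0 //; apply: le_trans hbeta _.
  by rewrite ler_peMr ?(ltW b0) // exprn_ege1 // ler1n.
pose eta := eps / 4.
(* Chosen so that both square roots of the error term are at most [eta / 48]. *)
pose delta := Num.min (eta / 2) (T * (eta / 48) ^+ 2 / 2).
have et0 : 0 < eta by [].
have dl1 : delta <= eta / 2 by rewrite ge_min lexx.
have dl2 : delta <= T * (eta / 48) ^+ 2 / 2 by rewrite ge_min lexx orbT.
have dl0 : 0 < delta by rewrite lt_min !divr_gt0 ?mulr_gt0 ?exprn_gt0 ?divr_gt0.
have err : delta + 12 * Num.sqrt (delta / T) + 12 * Num.sqrt (delta / T + delta) <= eta.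
  have dT : delta / T <= (eta / 48) ^+ 2 / 2.
    by rewrite ler_pdivrMr // mulrC mulrA.
  have dd : delta <= (eta / 48) ^+ 2 / 2.
    apply: le_trans dT; rewrite ler_pdivlMr //.
    by rewrite ler_piMr // ltW.
  have eta48 : 0 <= eta / 48 by rewrite divr_ge0 // ltW.
  have q0 : 0 <= (eta / 48) ^+ 2 by exact: sqr_ge0.
  have sq (u : R) : u <= (eta / 48) ^+ 2 -> Num.sqrt u <= eta / 48.
    move=> H; rewrite -[leRHS]mulr1 -[X in _ * X]sqrtr1.
    by apply: sqrt_le_scale => //; rewrite mulr1.
  have s1 : Num.sqrt (delta / T) <= eta / 48 by apply: sq; lra.
  have s2 : Num.sqrt (delta / T + delta) <= eta / 48 by apply: sq; lra.
  lra.
have [s Hs] : exists s, limn (series c) - \sum_(i < s) c i <= delta / 2.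
  have cc := calC_cvg C; have d20 : 0 < delta / 2 by rewrite divr_gt0.
  have /cvgrPdist_le /(_ _ d20) [s _ H] := cc.
  exists s; have := H s (leqnn s); rewrite seriesE.
  exact: le_trans (ler_norm _).
pose V := (2 * s * 2 ^ s)%N.
pose c1 := 1 - limn (series c).
have c10 : 0 < c1 by rewrite subr_gt0.
(* The polynomial factors amount to [2 * (n + 1) ^ (s + 2)], whose logarithm is at most [A * sqrt n]
   because [log2 (n + 1) <= 8 * sqrt n]. *)
pose A := 1 + 8 * s.+2%:R : R.
have A0 : 0 < A by rewrite (lt_le_trans ltr01) // lerDl mulr_ge0 ?ler0n.
(* In order, the summands give [1 <= n], [b < k], the hypotheses [small] and [room], and the
   absorption of the polynomial factors into [eta * n]. Of the budget [eps = 4 * eta], one [eta] is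
   lost in approximating [G], one in [err] and one here. *)
exists (1 + 2 ^+ b.+2 + V%:R / (delta / 2) + V.+1%:R / c1 + (A / eta) ^+ 2).
move=> k n hn nX.
have d20 : 0 < delta / 2 by rewrite divr_gt0.
have t1 : 0 <= V%:R / (delta / 2) by rewrite divr_ge0 ?ler0n // (ltW d20).
have t2 : 0 <= V.+1%:R / c1 by rewrite divr_ge0 ?ler0n // (ltW c10).
have t3 : 0 <= (A / eta) ^+ 2 by exact: sqr_ge0.
have t4 := p0 b.+2.
have n1 : 1 <= n%:R :> R by lra.
have n0 : 0 < n%:R :> R by lra.
have n_lt : n%:R < 2 ^+ k.+1 :> R by rewrite hn exprS (ltr_pM2r (p0 k)).
have bk : (b < k)%N.
  have : 2 ^+ b.+2 < 2 ^+ k.+1 :> R by apply: le_lt_trans n_lt; lra.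
  by rewrite ltr_eXn2l ?ltr1n // => /ltnW.
have small : limn (series c) - \sum_(i < s) c i + V%:R / n%:R <= delta.
  have : V%:R / n%:R <= delta / 2.
    rewrite ler_pdivrMr // mulrC -ler_pdivrMr ?divr_gt0 //; lra.
  lra.
have room : V.+1%:R <= n%:R * (1 - limn (series c)).
  by rewrite -ler_pdivrMr // -/c1; lra.
have := rho_min_upper_quant hbeta C PM hn bk small room.
set M' := _ + 12 * Num.sqrt (delta / _ + delta) => H; apply: (le_trans H).
have M'le : M' <= G beta + 2 * eta by rewrite /M' -/T; move: err; rewrite /eta; lra.
have sq1 : 1 <= Num.sqrt n%:R :> R by rewrite -[leLHS]sqrtr1 ler_wsqrtr.
have En : n%:R = Num.sqrt n%:R * Num.sqrt n%:R :> R.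
  by rewrite -expr2 sqr_sqrtr // ltW.
have An : A * Num.sqrt n%:R <= eta * n%:R.
  have : A / eta <= Num.sqrt n%:R.
    have -> : A / eta = Num.sqrt ((A / eta) ^+ 2).
      by rewrite sqrtr_sqr ger0_norm // divr_ge0 ?(ltW A0) ?(ltW et0).
    by rewrite ler_wsqrtr //; lra.
  rewrite ler_pdivrMr // => AE; rewrite [in leRHS]En mulrCA mulrA.
  rewrite [leRHS](_ : _ = (Num.sqrt n%:R * eta) * Num.sqrt n%:R); last by ring.
  by rewrite ler_pM2r // (lt_le_trans ltr01).
have ln1 : log2 n.+1%:R <= 8 * Num.sqrt n%:R :> R.
  apply: le_trans (log2_le_sqrt _) _; first by rewrite ler1n.
  have : Num.sqrt n.+1%:R <= 2 * Num.sqrt n%:R :> R.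
    apply: sqrt_le_scale; rewrite ?ler0n // -natr1 expr2; lra.
  lra.
have sln : s.+2%:R * log2 n.+1%:R <= s.+2%:R * (8 * Num.sqrt n%:R) :> R.
  by rewrite ler_wpM2l ?ler0n.
have E2 : 2 * ((n.+1 ^ s.+1)%:R * (n.+1%:R * 2 `^ (n%:R * M'))) =
    2 `^ (1 + s.+2%:R * log2 n.+1%:R + n%:R * M') :> R.
  have two : 2 = 2 `^ 1 :> R by rewrite powRr1.
  rewrite !powRD ?pnatr_eq0 ?implybT // -two -!mulrA; congr (_ * _).
  rewrite mulrA; congr (_ * _).
  rewrite [s.+2%:R * _]mulrC powRrM powR2_log2 ?ltr0n // powR_mulrn ?ler0n //.
  by rewrite exprSr natrX.
rewrite E2; apply: ler_powR; first by rewrite ler1n.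
have : n%:R * M' <= n%:R * (G beta + 2 * eta) by rewrite ler_pM2l.
have AE : A * Num.sqrt n%:R = Num.sqrt n%:R + s.+2%:R * (8 * Num.sqrt n%:R).
  by rewrite /A; ring.
have : eps * n%:R = 4 * (eta * n%:R) by rewrite /eta; field.
have : 0 <= eta * n%:R by rewrite mulr_ge0 ?ler0n // ltW.
move: An sln sq1; rewrite AE; lra.
Qed.

End Asymptotics.

Local Open Scope classical_set_scope.
Local Open Scope ring_scope.

Theorem theorem4p1 (R : realType) (beta : R) (hbeta : 1 <= beta < 2) :
  exists e : nat -> R,
    e =o_\oo (fun n : nat => n%:R : R) /\
    \forall k \near \oo, forall n : nat, n%:R = beta * 2 ^+ k ->
      2 `^ (G beta * n%:R - e n) <= rho_min R n <= 2 `^ (G beta * n%:R + e n).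
Proof.
pose valid n := exists k, n%:R = beta * 2 ^+ k.
(* The error term is the actual deviation on admissible [n] and 0 elsewhere. Being [o(n)] is then
   the conjunction of the two one-sided bounds for every [eps], and the sandwich only needs
   [rho_min] positive, which the lower bound with [eps = 1] gives. *)
exists (fun n => if `[< valid n >] then `|log2 (rho_min R n) - G beta * n%:R| else 0).
have pos2 x : 0 < 2 `^ x :> R by rewrite powR_gt0.
split.
  apply/eqoP => eps e0.
  have [XL HL] := rho_min_lower hbeta e0; have [XU HU] := rho_min_upper hbeta e0.
  apply: filterS2 (nbhs_infty_ger XL) (nbhs_infty_ger XU) => n nXL nXU /=.
  case: asboolP => [[k hn]|_]; last by rewrite normr0 mulr_ge0 // ltW.
  have L := HL k n hn nXL; have U := HU k n hn nXU.
  have r0 := lt_le_trans (pos2 _) L.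
  have := le_log2 (pos2 _) L; have := le_log2 r0 U; rewrite !log2_powR2 => L' U'.
  rewrite normr_id [`|n%:R|]ger0_norm ?ler0n // ler_norml.
  by apply/andP; split; lra.
have [X HX] := rho_min_lower hbeta ltr01.
apply: filterS (nbhs_infty_ger X) => k kX n hn /=.
case: asboolP => [_|[]]; last by exists k.
have nX : X <= n%:R.
  apply: (le_trans kX).
  rewrite hn; apply: le_trans (_ : 2 ^+ k <= _).
    by rewrite -natrX ler_nat ltnW // ltn_expl.
  by rewrite ler_peMl ?exprn_ge0 //; case/andP: hbeta.
have r0 := lt_le_trans (pos2 _) (HX k n hn nX).
have [a b] : log2 (rho_min R n) - G beta * n%:R <=
    `|log2 (rho_min R n) - G beta * n%:R| /\
    - (log2 (rho_min R n) - G beta * n%:R) <=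
    `|log2 (rho_min R n) - G beta * n%:R|.
  by split; [exact: ler_norm | rewrite -normrN; exact: ler_norm].
apply/andP; split.
  by rewrite -[leRHS]powR2_log2 //; apply: ler_powR; [rewrite ler1n | lra].
by rewrite -[leLHS]powR2_log2 //; apply: ler_powR; [rewrite ler1n | lra].
Qed.
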